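(* Let $(V,m_V)$ be a $C_\infty$-algebra. Then there exists a minimal $C_\infty$-algebra $(U,m_U)$ and a weak equivalence of $C_\infty$-algebras $(U,m_U)\to(V,m_V)$.
   Context: The ground ring $\mathbb K$ is assumed to be a field, or more generally a graded field (a graded commutative ring whose nonzero homogeneous elements are invertible), evenly graded and containing $\mathbb Q$. All modules are graded, with cohomological grading and Koszul signs. $(\Sigma V)^i:=V^{i+1}$ and $\Sigma V^*$ means $\mathrm{Hom}_{\mathbb K}(\Sigma V,\mathbb K)$, a profinite module (inverse limit of free modules of finite rank, with the inverse limit topology). For $W$ profinite, $\widehat TW:=\prod_{i\ge0}W^{\hat\otimes i}$ (completed tensor powers) and $\widehat LW\subset\widehat TW$ is the Lie subalgebra, under the graded commutator, of all convergent (possibly infinite) linear combinations of Lie monomials. A $C_\infty$-structure on a free graded module $V$ is a continuous derivation $m:\widehat L\Sigma V^*\to\widehat L\Sigma V^*$ of degree one with $m^2=0$; $(V,m)$ is then a $C_\infty$-algebra. Write $m=m_1+m_2+\cdots$ where $m_i$ is the part of order $i$, i.e. $m_i$ sends $\Sigma V^*$ into $(\Sigma V^* )^{\hat\otimes i}$. Then $m_1^2=0$, so $m_1$ makes $\Sigma V^*$, and dually $V$, into a complex. The algebra is minimal if $m_1=0$. A $C_\infty$-morphism from $(V,m)$ to $(U,m')$ is a continuous Lie algebra homomorphism $\phi:\widehat L\Sigma U^*\to\widehat L\Sigma V^*$ of degree zero with $\phi\circ m'=m\circ\phi$. Its linear part $\Sigma U^*\to\Sigma V^*$ is dual to a map of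 complexes $V\to U$; $\phi$ is a weak equivalence if this map of complexes is a quasi-isomorphism. *)

(* Defs.v *)
From HB Require Import structures.
From mathcomp Require Import all_boot all_order all_algebra.
From mathcomp Require Import all_classical topology.

Set Implicit Arguments.
Unset Strict Implicit.
Unset Printing Implicit Defensive.

Import GRing.Theory.

Local Open Scope classical_set_scope.
Local Open Scope ring_scope.

(* M is the internal direct sum of the subgroups gr i, i : int. *)
Definition is_grading (M : zmodType) (gr : int -> set M) : Prop :=
  [/\ forall i, gr i 0,
      forall i x y, gr i x -> gr i y -> gr i (x - y)
    & forall x, exists! c : int -> M,
        [/\ forall i, gr i (c i),
            finite_set [set i | c i != 0]
          & x = \sum_(i \in setT) c i]].

(* Being evenly graded, a graded commutative ring is strictly commutative. *)
Record gradedField := GradedField {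
  gf_ring :> comNzRingType;
  gf_gr : int -> set gf_ring;
  gf_grading : is_grading gf_gr;
  gf_one : gf_gr 0 1;
  gf_mul : forall i j x y, gf_gr i x -> gf_gr j y -> gf_gr (i + j) (x * y);
  gf_inv : forall i x, gf_gr i x -> x != 0 -> exists y, x * y = 1;
  gf_even : forall i x, odd `|i|%N -> gf_gr i x -> x = 0;
  gf_rat : inhabited {rmorphism rat -> gf_ring} }.

Record gradedModule (K : gradedField) := GradedModule {
  gm_mod :> lmodType K;
  gm_gr : int -> set gm_mod;
  gm_grading : is_grading gm_gr;
  gm_scale : forall i j a v,
    gf_gr i a -> gm_gr j v -> gm_gr (i + j) (a *: v) }.

Definition graded_free (K : gradedField) (V : gradedModule K) : Prop :=
  exists (B : choiceType) (e : B -> V) (deg : B -> int),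
    (forall b, gm_gr (deg b) (e b)) /\
    forall v : V, exists! c : B -> K,
      finite_set [set b | c b != 0] /\ v = \sum_(b \in setT) c b *: e b.

Lemma susp_grading (M : zmodType) (gr : int -> set M) :
  is_grading gr -> is_grading (fun i => gr (i + 1)).
Proof.
have bijB : bijective (fun i : int => i - 1).
  by exists (fun i => i + 1) => i; rewrite ?subrK ?addrK.
have bijD : bijective (fun i : int => i + 1).
  by exists (fun i => i - 1) => i; rewrite ?subrK ?addrK.
case=> g0 gB gx; split=> [i|i x y|x]; [exact: g0|exact: gB|].
have [c [[cg cf ->] cu]] := gx x.
exists (fun i => c (i + 1)); split=> [|c' [c'g c'f c'E]].
  split=> [i //||]; last exact: (reindex_fsbigT (fun i : int => i + 1)).
  apply: (@finite_preimage _ _ [set i | c i != 0] (fun i : int => i + 1)) => //.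
  by move=> i j _ _; exact: addIr.
have cE : c = fun i => c' (i - 1).
  apply: cu; split=> [i||].
  - by have := c'g (i - 1); rewrite subrK.
  - apply: (@finite_preimage _ _ [set i | c' i != 0] (fun i : int => i - 1)) => //.
    by move=> i j _ _; exact: addIr.
  - rewrite c'E; exact: (reindex_fsbigT (fun i : int => i - 1)).
by apply/funext => i; rewrite cE addrK.
Qed.

Lemma susp_scale (K : gradedField) (V : gradedModule K) i j (a : K) (v : V) :
  gf_gr i a -> gm_gr (j + 1) v -> gm_gr (i + j + 1) (a *: v).
Proof. by move=> ai vj; rewrite -addrA; exact: gm_scale. Qed.

(* (Sigma V)^i = V^(i+1) *)
Definition susp (K : gradedField) (V : gradedModule K) : gradedModule K :=
  GradedModule (susp_grading (gm_grading V)) (@susp_scale K V).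

Section CompletedAlgebras.
Variables (K : gradedField) (M : gradedModule K).

(* The completed tensor algebra of the profinite module M^* = Hom_K(M, K).   *)
(* The n-th completed tensor power of M^* is the dual of the n-th tensor     *)
(* power of M, i.e. the module of K-multilinear forms in n arguments from M; *)
(* a sequence of such forms, one for each n, is encoded as a single function *)
(* on words in M.  The tensor f1 (x) ... (x) fn of elements of M^* is sent   *)
(* to v1 ... vn |-> f1(v1) * ... * fn(vn).  This identification carries no   *)
(* Koszul sign; it is K-linear as K is even, and it turns the product of the *)
(* tensor algebra into conv below.                                           *)
Definition series := seq M -> K.

(* The word s represents an element of degree d of a tensor power of M. *)
Fixpoint word_deg (s : seq M) (d : int) : Prop :=
  if s is v :: s' then exists2 i, gm_gr i v & word_deg s' (d - i) else d = 0.

Definition multilinear (f : series) : Prop :=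
  forall (s t : seq M) (a : K) (x y : M),
    f (s ++ (a *: x + y) :: t) = a * f (s ++ x :: t) + f (s ++ y :: t).

(* Component of degree d of the completed tensor algebra.  Graded modules are *)
(* handled through their homogeneous elements.                                *)
Definition hatT (d : int) (f : series) : Prop :=
  multilinear f /\ forall s i, word_deg s i -> gf_gr (d + i) (f s).

Definition conv (f g : series) : series :=
  fun s => \sum_(k < (size s).+1) f (take k s) * g (drop k s).

Definition sgn (d : int) : K := (-1) ^+ `|d|%N.

(* Graded commutator of f and g of respective degrees d and e. *)
Definition brk (d e : int) (f g : series) : series :=
  fun s => conv f g s - sgn (d * e) * conv g f s.

Definition dual_deg (d : int) (a : {scalar M}) : Prop :=
  forall i v, gm_gr i v -> gf_gr (d + i) (a v).

(* The inclusion of M^* in its completed tensor algebra. *)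
Definition gen (a : {scalar M}) : series :=
  fun s => if s is [:: v] then a v else 0.

Inductive lie_monomial : int -> series -> Prop :=
| lie_gen d (a : {scalar M}) : dual_deg d a -> lie_monomial d (gen a)
| lie_brk d e f g :
    lie_monomial d f -> lie_monomial e g -> lie_monomial (d + e) (brk d e f g).

(* Component of degree d of the completed free Lie algebra: sums of families *)
(* c i * l i, with l i a Lie monomial, that converge in the topology of      *)
(* pointwise convergence with K discrete (top_series), i.e. such that only   *)
(* finitely many terms are nonzero on each word.                             *)
Definition hatL (d : int) (f : series) : Prop :=
  hatT d f /\
  exists (I : choiceType) (c : I -> K) (l : I -> series) (p q : I -> int),
    (forall i, [/\ gf_gr (p i) (c i), lie_monomial (q i) (l i)
                 & p i + q i = d]) /\
    forall s, finite_set [set i | c i * l i s != 0] /\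
              f s = \sum_(i \in setT) c i * l i s.

(* The inverse limit topology on M^* and its completed tensor powers is the *)
(* topology of pointwise convergence, K being discrete.                     *)
Definition top_series := {ptws (seq M) -> discrete_topology K}.

End CompletedAlgebras.

(* Maps between completed free Lie algebras are given by functions on all    *)
(* series; only their values on the components hatL d are ever constrained.  *)
Section Maps.
Variables (K : gradedField) (M N : gradedModule K).

Definition contL (D : series M -> series N) : Prop :=
  forall d, {within [set f : top_series M | hatL d f],
    continuous (D : top_series M -> top_series N)}.

(* D raises degrees by the integer p.  No sign in K-linearity, as K is even. *)
Definition linearL (p : int) (D : series M -> series N) : Prop :=
  [/\ forall d f, hatL d f -> hatL (d + p) (D f),
      forall d f g, hatL d f -> hatL d g -> D (f \+ g) = D f \+ D g
    & forall i d a f, gf_gr i a -> hatL d f -> D (a \*o f) = a \*o D f].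

Definition lie_hom (phi : series M -> series N) : Prop :=
  [/\ linearL 0 phi, contL phi
    & forall d e f g, hatL d f -> hatL e g ->
        phi (brk d e f g) = brk d e (phi f) (phi g)].

End Maps.

Definition derivation1 (K : gradedField) (M : gradedModule K)
    (D : series M -> series M) : Prop :=
  [/\ linearL 1 D, contL D
    & forall d e f g, hatL d f -> hatL e g ->
        D (brk d e f g) =
        brk (d + 1) e (D f) g \+ sgn K d \*o brk d (e + 1) f (D g)].

Record cinfAlgebra (K : gradedField) := CinfAlgebra {
  ci_mod :> gradedModule K;
  ci_free : graded_free ci_mod;
  ci_m : series (susp ci_mod) -> series (susp ci_mod);
  ci_der : derivation1 ci_m;
  ci_sq : forall d f, hatL d f -> forall s, ci_m (ci_m f) s = 0 }.

(* m_1 a is the restriction of m a to words of length 1. *)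
Definition minimal (K : gradedField) (V : cinfAlgebra K) : Prop :=
  forall d (a : {scalar (susp V)}), dual_deg d a ->
    forall v : susp V, ci_m (gen a) [:: v] = 0.

Record cinfMorphism (K : gradedField) (V U : cinfAlgebra K) := CinfMorphism {
  cm_fun : series (susp U) -> series (susp V);
  cm_hom : lie_hom cm_fun;
  cm_comm : forall d f, hatL d f -> cm_fun (ci_m f) = ci_m (cm_fun f) }.

(* dV is the differential of V whose dual is m_1, with the Koszul sign of the *)
(* transpose of a map of degree 1.                                            *)
Definition dual_differential (K : gradedField) (V : cinfAlgebra K)
    (dV : {linear V -> V}) : Prop :=
  forall d (a : {scalar (susp V)}), dual_deg d a ->
    forall v : V, ci_m (gen a) [:: (v : susp V)] = sgn K d * a (dV v).

Definition dual_linear_part (K : gradedField) (V U : cinfAlgebra K)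
    (phi : cinfMorphism V U) (F : {linear V -> U}) : Prop :=
  forall d (a : {scalar (susp U)}), dual_deg d a ->
    forall v : V, cm_fun phi (gen a) [:: (v : susp V)] = a (F v).

(* F is a map of complexes inducing bijections on cohomology. *)
Definition quasi_iso (K : gradedField) (V U : gradedModule K)
    (dV : {linear V -> V}) (dU : {linear U -> U}) (F : {linear V -> U}) : Prop :=
  [/\ forall n v, gm_gr n v -> gm_gr n (F v),
      forall v, F (dV v) = dU (F v),
      forall n v, gm_gr n v -> dV v = 0 ->
        (exists2 u, gm_gr (n - 1) u & F v = dU u) ->
        exists2 w, gm_gr (n - 1) w & v = dV w
    & forall n u, gm_gr n u -> dU u = 0 ->
        exists2 v, gm_gr n v & dV v = 0 /\
        exists2 w, gm_gr (n - 1) w & u - F v = dU w].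

(* V and U being free, dV, dU and F are determined by m and phi. *)
Definition weak_equivalence (K : gradedField) (V U : cinfAlgebra K)
    (phi : cinfMorphism V U) : Prop :=
  exists (dV : {linear V -> V}) (dU : {linear U -> U}) (F : {linear V -> U}),
    [/\ dual_differential dV, dual_differential dU,
        dual_linear_part phi F & quasi_iso dV dU F].

(* Main.v *)
From HB Require Import structures.
From mathcomp Require Import all_boot all_order all_algebra.
From mathcomp Require Import all_classical topology.
From mathcomp Require Import finmap zify ring.
Require Import Defs.

Set Implicit Arguments.
Unset Strict Implicit.
Unset Printing Implicit Defensive.

Import GRing.Theory.

Local Open Scope classical_set_scope.
Local Open Scope ring_scope.

(** The theorem is homotopy transfer along a contraction of V onto its cohomology,
    in dual form.

    A series is a function on words, so Lie morphisms and derivations are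
    transposes of maps that send a word to a sum of words.  A map F from words to
    letters gives the morphism that cuts a word into blocks and applies F to each
    of them (pull (blocks F)); a map Q gives the derivation that replaces one factor
    of a word by its image under Q (pull (slots eps Q)).  Only the odd map Q
    produces signs; as scalars are even, they are carried by the involution eps that
    multiplies each letter by its parity, and no formula mentions degrees.

    By continuity the structure m of V is, on generators, the transpose of a map of
    words (operator_transpose), with linear part d and remainder G
    (transpose_exists).  A graded field has invertible homogeneous elements, so the
    exchange lemma holds and V has homogeneous maps p onto, i from, and h around a
    model U of its cohomology, spanned by some of the basis vectors of V, with
    d h + h d = i p - 1, p i = 1 and d i = 0 (contraction_exists).  Put
      F = i + h G(F, ..., F)   and   Q = p G(F, ..., F),
    a recursion on the length of words.  They define phi and m_U.  The defect
    E = phi m - m_U phi satisfies a Leibniz rule, and on a generator a one finds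
    E(a) = E((a h) G), where (a h) G has no linear part.  On a word of length n, the
    Leibniz rule expresses E of a series without linear part by values of E on
    shorter words (leibniz_vanish), so E = 0 by induction.  The same induction gives
    m_U m_U = 0.  Since Q has no linear part, U is minimal; the linear part of phi
    is dual to i, a quasi-isomorphism.

    It remains to see that phi and m_U preserve the completed Lie algebra, which is
    defined by convergent families of Lie monomials.  A limit of such series is not
    visibly of that form.  The key fact is that the completed Lie algebra is closed
    for pointwise convergence (closL_hatL).  Sorting words in a basis by their
    content up to rearrangement, a limit f decomposes into pieces that only see the
    finitely many rearrangements of one word; each piece is a finite combination of
    Lie monomials in the dual basis with exactly these letters, and such monomials
    form a summable family.  Once membership is a closure condition, it passes
    through phi and m_U, since a value of their output depends on finitely many
    values of the input. *)

(** * Graded groups and graded fields *)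

Lemma finsum_seq (R : nmodType) (T : choiceType) (A : seq T) (f : T -> R) :
  uniq A -> (forall i, i \notin A -> f i = 0) ->
  \sum_(i \in setT) f i = \sum_(i <- A) f i.
Proof.
move=> uA f0; rewrite (fsbigE A) //; last by move=> i _; exact: f0.
by apply: eq_bigl => i; apply/mem_set.
Qed.

Lemma finite_set_uniq_seq (T : choiceType) (A : set T) : finite_set A ->
  exists2 s : seq T, uniq s & forall i, (i \in s) <-> A i.
Proof.
move=> finA; exists (fset_set A) => [|i]; first exact: fset_uniq.
by rewrite in_fset_set //; split=> [/set_mem|/mem_set].
Qed.

Lemma uniq_seq_finite_set (T : choiceType) (A : set T) (s : seq T) :
  (forall i, A i -> i \in s) -> finite_set A.
Proof. by move=> h; apply: (sub_finite_set _ (finite_seq s)) => i /h. Qed.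

(** The homogeneous components of x, by choice from their existence; 0 serves as
    a default when gr is not a grading. *)
Definition hcomp (M : zmodType) (gr : int -> set M) (i : int) (x : M) : M :=
  xget (fun=> 0) [set c : int -> M |
    [/\ forall i, gr i (c i), finite_set [set i | c i != 0]
      & x = \sum_(i \in setT) c i]] i.

Section Gradings.
Variables (M : zmodType) (gr : int -> set M).
Hypothesis grP : is_grading gr.

Lemma gr0 i : gr i 0. Proof. by case: grP. Qed.

Lemma grB i x y : gr i x -> gr i y -> gr i (x - y).
Proof. by case: grP => _ h _; exact: h. Qed.

Lemma grN i x : gr i x -> gr i (- x).
Proof. by rewrite -sub0r; apply: grB; exact: gr0. Qed.

Lemma grD i x y : gr i x -> gr i y -> gr i (x + y).
Proof. by move=> gx gy; rewrite -[y]opprK; apply: grB => //; exact: grN. Qed.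

Lemma gr_sum i (T : Type) (s : seq T) (P : pred T) (F : T -> M) :
  (forall t, P t -> gr i (F t)) -> gr i (\sum_(t <- s | P t) F t).
Proof. move=> h; apply: big_ind => //; [exact: gr0|exact: grD]. Qed.

Lemma hcompP x :
  [/\ forall i, gr i (hcomp gr i x), finite_set [set i | hcomp gr i x != 0]
    & x = \sum_(i \in setT) hcomp gr i x].
Proof.
rewrite /hcomp; case: xgetP => [c _ //|]; case: grP => _ _ /(_ x) [c [cP _]].
by move=> /(_ c) /(_ cP).
Qed.

Lemma gr_hcomp i x : gr i (hcomp gr i x). Proof. by case: (hcompP x). Qed.

Lemma hcomp_seq x : exists A : seq int, [/\ uniq A,
  forall i, i \notin A -> hcomp gr i x = 0 & x = \sum_(i <- A) hcomp gr i x].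
Proof.
case: (hcompP x) => _ fin e.
have [A uA AP] := finite_set_uniq_seq fin.
have A0 i : i \notin A -> hcomp gr i x = 0.
  by move=> iA; apply/eqP; apply: contraNT iA => ci; apply/AP.
by exists A; split=> //; rewrite {1}e; exact: finsum_seq.
Qed.

Lemma hcomp_uniq x (A : seq int) (c : int -> M) : uniq A ->
  (forall i, gr i (c i)) -> (forall i, i \notin A -> c i = 0) ->
  x = \sum_(i <- A) c i -> forall i, hcomp gr i x = c i.
Proof.
move=> uA cg c0 xE i; have [_ _ /(_ x) [c' [c'P c'u]]] := grP.
rewrite -[LHS]/((fun k => hcomp gr k x) i) -(c'u _ (hcompP x)).
congr (_ i); apply: c'u; split=> //.
- apply: (@uniq_seq_finite_set _ _ A) => j /=; apply: contraR => jA.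
  by rewrite c0.
- by rewrite (finsum_seq uA c0).
Qed.

Lemma hcomp_id i x : gr i x -> hcomp gr i x = x.
Proof.
move=> gx; rewrite (@hcomp_uniq x [:: i] (fun j => if j == i then x else 0)) //.
- by rewrite eqxx.
- by move=> j; case: eqP => [->|_] //; exact: gr0.
- by move=> j; rewrite inE => /negbTE ->.
- by rewrite big_seq1 eqxx.
Qed.

Lemma hcomp_neq i j x : gr i x -> j != i -> hcomp gr j x = 0.
Proof.
move=> gx ji; rewrite (@hcomp_uniq x [:: i] (fun j => if j == i then x else 0)) //.
- by rewrite (negbTE ji).
- by move=> k; case: eqP => [->|_] //; exact: gr0.
- by move=> k; rewrite inE => /negbTE ->.
- by rewrite big_seq1 eqxx.
Qed.

Lemma hcompB i x y : hcomp gr i (x - y) = hcomp gr i x - hcomp gr i y.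
Proof.
have [A [uA A0 xE]] := hcomp_seq x; have [B [uB B0 yE]] := hcomp_seq y.
have sumE z (C D : seq int) : uniq C -> uniq D ->
  {subset C <= D} -> (forall k, k \notin C -> hcomp gr k z = 0) ->
  \sum_(i <- C) hcomp gr i z = \sum_(i <- D) hcomp gr i z.
  move=> uC uD CD C0; rewrite -(finsum_seq uC C0) -(finsum_seq uD) // => k kD.
  by apply: C0; apply: contra kD; exact: CD.
apply: (@hcomp_uniq _ (undup (A ++ B)) (fun i => hcomp gr i x - hcomp gr i y)).
- exact: undup_uniq.
- by move=> k; apply: grB; exact: gr_hcomp.
- move=> k; rewrite mem_undup mem_cat negb_or => /andP[kA kB].
  by rewrite A0 // B0 // subrr.
- rewrite sumrB {1}xE {1}yE; congr (_ - _); apply: sumE => //.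
  + exact: undup_uniq.
  + by move=> k kA; rewrite mem_undup mem_cat kA.
  + exact: undup_uniq.
  + by move=> k kA; rewrite mem_undup mem_cat kA orbT.
Qed.

Lemma hcomp_zero i : hcomp gr i 0 = 0.
Proof. by rewrite -{1}(subrr (0 : M)) hcompB subrr. Qed.

Lemma hcompD i x y : hcomp gr i (x + y) = hcomp gr i x + hcomp gr i y.
Proof.
have e : hcomp gr i (- y) = - hcomp gr i y.
  by rewrite -sub0r hcompB hcomp_zero sub0r.
by rewrite -{1}[y]opprK hcompB e opprK.
Qed.

Lemma hcomp_sum i (T : Type) (s : seq T) (P : pred T) (F : T -> M) :
  hcomp gr i (\sum_(t <- s | P t) F t) = \sum_(t <- s | P t) hcomp gr i (F t).
Proof. exact: (big_morph _ (hcompD i) (hcomp_zero i)). Qed.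

Lemma hcomp_eq0 x : (forall i, hcomp gr i x = 0) -> x = 0.
Proof. by move=> h; have [A [_ _ ->]] := hcomp_seq x; rewrite big1. Qed.

End Gradings.

Section GradedFields.
Variable K : gradedField.
Let KP := gf_grading K.

Lemma sgnD d e : sgn K (d + e) = sgn K d * sgn K e.
Proof.
rewrite /sgn -signr_odd -[in RHS]signr_odd -[X in _ = _ * X]signr_odd.
by rewrite -signr_addb; congr (_ ^+ nat_of_bool _); lia.
Qed.

Lemma sgn1 : sgn K 1 = -1. Proof. by rewrite /sgn expr1. Qed.

Lemma sgnE d : sgn K d = (-1) ^+ odd `|d|%N.
Proof. by rewrite /sgn signr_odd. Qed.

Lemma sgn_sq d : sgn K d * sgn K d = 1.
Proof. by rewrite sgnE -signr_addb addbb. Qed.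

Lemma sgn_cat d e : odd `|d|%N = odd `|e|%N -> sgn K d = sgn K e.
Proof. by rewrite !sgnE => ->. Qed.

(** Scalars have even degree, so they do not contribute to Koszul signs. *)
Lemma sgn_scal p q (c : K) : gf_gr p c -> sgn K (p + q) * c = sgn K q * c.
Proof.
move=> cp; rewrite sgnD; case: (boolP (odd `|p|%N)) => op.
  by rewrite (gf_even op cp) !mulr0.
by rewrite [sgn K p]sgnE (negbTE op) mul1r.
Qed.

(** In the product of x with any inverse, only the component of degree -i of that
    inverse contributes to the degree of 1. *)
Lemma gf_inv_homog i (x : K) : gf_gr i x -> x != 0 ->
  exists2 y, gf_gr (- i) y & x * y = 1.
Proof.
move=> xi x0; have [y xy] := gf_inv xi x0.
exists (hcomp (@gf_gr K) (- i) y); first exact: gr_hcomp.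
have [A [uA A0 yE]] := hcomp_seq KP y.
have := xy; rewrite {1}yE mulr_sumr => e.
have := congr1 (hcomp (@gf_gr K) 0) e; rewrite (hcomp_id KP (gf_one K)) => <-.
rewrite hcomp_sum //; case: (boolP (- i \in A)) => iA.
  rewrite (bigD1_seq (- i)) //= big1 ?addr0 => [|j ji].
    have := gf_mul xi (gr_hcomp KP (- i) y); rewrite subrr.
    by move/(hcomp_id KP) ->.
  apply: (hcomp_neq KP (gf_mul xi (gr_hcomp KP j y))).
  by apply: contra ji => /eqP ij; apply/eqP; lia.
rewrite A0 // mulr0 big_seq big1 // => j jA.
apply: (hcomp_neq KP (gf_mul xi (gr_hcomp KP j y))).
by apply: contra iA => /eqP ij; have <- : j = - i by lia.
Qed.

End GradedFields.

(** * Words, Lie monomials and their limits *)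

Section Words.
Variables (K : gradedField) (M : gradedModule K).
Implicit Types (f g h l : series M) (s t w : seq M) (d e p q i j : int).

Lemma conv_nil f g : conv f g [::] = f [::] * g [::].
Proof. by rewrite /conv big_ord1. Qed.

Lemma conv_cons f g x s :
  conv f g (x :: s) = f [::] * g (x :: s) + conv (fun t => f (x :: t)) g s.
Proof. by rewrite /conv big_ord_recl take0 drop0. Qed.

Lemma eq_conv f f' g g' s :
  (forall k, f (take k s) = f' (take k s)) ->
  (forall k, g (drop k s) = g' (drop k s)) -> conv f g s = conv f' g' s.
Proof. by move=> ef eg; apply: eq_bigr => k _; rewrite ef eg. Qed.

Lemma conv_linl (c : K) f f' g s :
  conv (fun s => c * f s + f' s) g s = c * conv f g s + conv f' g s.
Proof.
rewrite /conv mulr_sumr -big_split; apply: eq_bigr => k _ /=.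
by rewrite mulrDl mulrA.
Qed.

Lemma conv_linr (c : K) f g g' s :
  conv f (fun s => c * g s + g' s) s = c * conv f g s + conv f g' s.
Proof.
rewrite /conv mulr_sumr -big_split; apply: eq_bigr => k _ /=.
by rewrite mulrDr mulrCA.
Qed.

Lemma conv0l g s : conv (fun=> 0) g s = 0.
Proof. by rewrite /conv big1 // => k _; rewrite mul0r. Qed.

Lemma conv0r f s : conv f (fun=> 0) s = 0.
Proof. by rewrite /conv big1 // => k _; rewrite mulr0. Qed.

(** A scalar c of degree p changes degrees by an even amount only, so a bracket with
    l and a bracket with c * l are formed with the same sign. *)
Lemma sgn_scalM p q e (c : K) :
  gf_gr p c -> sgn K ((p + q) * e) * c = sgn K (q * e) * c.
Proof.
move=> cp; case: (boolP (odd `|p|%N)) => op.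
  by rewrite (gf_even op cp) !mulr0.
by rewrite mulrDl sgnD [sgn K (p * e)]sgnE abszM oddM (negbTE op) mul1r.
Qed.

Lemma brk_linl p q e (c : K) l f g s : gf_gr p c ->
  brk (p + q) e (fun s => c * l s + f s) g s =
  c * brk q e l g s + brk (p + q) e f g s.
Proof.
move=> cp; rewrite /brk conv_linl conv_linr mulrDr mulrA sgn_scalM //.
by rewrite mulrBr opprD addrACA mulrA [_ * c]mulrC.
Qed.

Lemma brk_linr p q d (c : K) l f g s : gf_gr p c ->
  brk d (p + q) f (fun s => c * l s + g s) s =
  c * brk d q f l s + brk d (p + q) f g s.
Proof.
move=> cp; rewrite /brk conv_linl conv_linr mulrDr mulrA.
rewrite [d * (p + q)]mulrC sgn_scalM // [q * d]mulrC.
by rewrite mulrBr opprD addrACA mulrA [_ * c]mulrC.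
Qed.

Lemma brk0l d e g s : brk d e (fun=> 0) g s = 0.
Proof. by rewrite /brk conv0l conv0r mulr0 subr0. Qed.

Lemma brk0r d e f s : brk d e f (fun=> 0) s = 0.
Proof. by rewrite /brk conv0l conv0r mulr0 subr0. Qed.

(** The words on which the values of a bracket on S depend. *)
Definition factors (S : seq (seq M)) : seq (seq M) :=
  flatten [seq [seq take k s | k <- iota 0 (size s).+1] ++
               [seq drop k s | k <- iota 0 (size s).+1] | s <- S].

Lemma mem_factors S s k : s \in S ->
  (take k s \in factors S) /\ (drop k s \in factors S).
Proof.
move=> sS.
have [k' [k'i -> ->]] : exists k', [/\ k' \in iota 0 (size s).+1,
    take k s = take k' s & drop k s = drop k' s].
  have [ks|ks] := leqP k (size s).
    by exists k; rewrite mem_iota.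
  exists (size s); split; first by rewrite mem_iota leq0n add0n ltnS leqnn.
    by rewrite take_size take_oversize // ltnW.
  by rewrite drop_size drop_oversize // ltnW.
by split; apply/flatten_mapP; exists s => //; rewrite mem_cat; apply/orP;
  [left|right]; apply/mapP; exists k'.
Qed.

Lemma eq_brk d e f f' g g' S :
  {in factors S, f =1 f'} -> {in factors S, g =1 g'} ->
  {in S, brk d e f g =1 brk d e f' g'}.
Proof.
move=> ef eg s sS; have ms k := mem_factors k sS.
rewrite /brk; congr (_ - _ * _); apply: eq_conv => k.
- by apply: ef; case: (ms k).
- by apply: eg; case: (ms k).
- by apply: eg; case: (ms k).
- by apply: ef; case: (ms k).
Qed.

Lemma word_deg_cat s t i : word_deg (s ++ t) i <->
  exists2 j, word_deg s j & word_deg t (i - j).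
Proof.
elim: s i => [|v s IH] i /=.
  by split=> [h|[j -> ]]; [exists 0 => //; rewrite subr0|rewrite subr0].
split=> [[j vj /IH [k sk tk]]|[j [k vk sk] tk]].
  by exists (j + k); [exists j => //; rewrite addrC addKr|rewrite opprD addrA].
exists k => //; apply/IH; exists (j - k) => //.
by have -> : i - k - (j - k) = i - j by lia.
Qed.

Lemma gf_gr_sgn d i (x : K) : gf_gr i x -> gf_gr i (sgn K d * x).
Proof.
move=> xi; rewrite sgnE; case: odd; rewrite ?mulN1r ?mul1r //.
exact: (grN (gf_grading K)).
Qed.

Lemma hatT_conv d e f g : hatT d f -> hatT e g -> hatT (d + e) (conv f g).
Proof.
move=> [mf df] [mg dg]; split=> [s t a x y|s i si].
  rewrite /conv !size_cat /= mulr_sumr -big_split; apply: eq_bigr => k _ /=.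
  rewrite !take_cat !drop_cat; case: ltnP => ks; last first.
    case: (k - size s)%N => [|k'] /=; last by rewrite mf mulrDl mulrA.
    by rewrite cats0 -[_ :: t]cat0s mg mulrDr mulrCA.
  by rewrite mg mulrDr mulrCA.
apply: (gr_sum (gf_grading K)) => k _.
have /word_deg_cat[j sj tj] : word_deg (take k s ++ drop k s) i.
  by rewrite cat_take_drop.
have := gf_mul (df _ _ sj) (dg _ _ tj).
by have -> : d + j + (e + (i - j)) = d + e + i by lia.
Qed.

Lemma hatT_lin p q d (c : K) f g : gf_gr p c -> p + q = d ->
  hatT q f -> hatT d g -> hatT d (fun s => c * f s + g s).
Proof.
move=> cp <- [mf df] [mg dg]; split=> [s t a x y|s i si].
  by rewrite mf mg !mulrDr addrACA mulrCA.
apply: (grD (gf_grading K)); last exact: dg.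
by rewrite -addrA; apply: gf_mul => //; exact: df.
Qed.

Lemma hatT0 d : @hatT K M d (fun=> 0).
Proof.
by split=> [s t a x y|s i _]; [rewrite mulr0 addr0|exact: (gr0 (gf_grading K))].
Qed.

Lemma hatT_brk d e f g : hatT d f -> hatT e g -> hatT (d + e) (brk d e f g).
Proof.
move=> hf hg.
have [m1 d1] := hatT_conv hf hg; have [m2 d2] := hatT_conv hg hf.
split=> [s t a x y|s i si].
  by rewrite /brk m1 m2 mulrBr !mulrDr opprD addrACA mulrCA.
apply: (grB (gf_grading K)); first exact: d1.
by apply: gf_gr_sgn; rewrite [d + e]addrC; exact: d2.
Qed.

Lemma hatT_gen d (a : {scalar M}) : dual_deg d a -> hatT d (gen a).
Proof.
move=> da; split=> [s t c x y|s i].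
  by case: s => [|? [|? ?]]; case: t => [|? ?] /=;
    rewrite ?mulr0 ?addr0 // linearP.
case: s => [|v [|? ?]] /=.
- by move=> _; exact: (gr0 (gf_grading K)).
- by move=> [j vj /eqP]; rewrite subr_eq0 => /eqP ->; exact: da.
- by move=> _; exact: (gr0 (gf_grading K)).
Qed.

Lemma hatT_lie d l : lie_monomial d l -> hatT d l.
Proof. by elim=> *; [exact: hatT_gen|exact: hatT_brk]. Qed.

Lemma lie_nil d l : lie_monomial d l -> l [::] = 0.
Proof.
elim=> // {}d e f g _ f0 _ g0.
by rewrite /brk !conv_nil f0 mul0r mulr0 mulr0 subrr.
Qed.

(** The class X varies: besides Lie monomials it will be the brackets, and the
    monomials that involve a prescribed word of basis vectors. *)
Inductive comb (X : int -> series M -> Prop) (d : int) : series M -> Prop :=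
| comb0 : comb X d (fun=> 0)
| combS p q c l f : gf_gr p c -> X q l -> p + q = d -> comb X d f ->
    comb X d (fun s => c * l s + f s).

Lemma comb1 (X : int -> series M -> Prop) d l : X d l -> comb X d l.
Proof.
move=> Xl; have -> : l = (fun s => 1 * l s + (fun=> 0) s).
  by apply/funext => s; rewrite mul1r addr0.
by apply: (combS (gf_one K) Xl); [rewrite add0r|exact: comb0].
Qed.

Lemma combD X d f g : comb X d f -> comb X d g -> comb X d (fun s => f s + g s).
Proof.
move=> hf hg; elim: hf => [|p q c l {}f cp Xl pq _ IH].
  by under eq_fun do rewrite add0r.
by under eq_fun do rewrite -addrA; exact: (combS cp Xl pq IH).
Qed.

Lemma combZ X d f i (a : K) : gf_gr i a -> comb X d f ->
  comb X (i + d) (fun s => a * f s).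
Proof.
move=> ai; elim=> [|p q c l {}f cp Xl pq _ IH].
  by under eq_fun do rewrite mulr0; exact: comb0.
under eq_fun do rewrite mulrDr mulrA.
by apply: (combS (gf_mul ai cp) Xl) IH; rewrite -pq addrA.
Qed.

Lemma comb_bind X Y d f : (forall q l, X q l -> comb Y q l) ->
  comb X d f -> comb Y d f.
Proof.
move=> XY; elim=> [|p q c l {}f cp Xl pq _ IH]; first exact: comb0.
by apply: combD IH; rewrite -pq; apply: combZ => //; exact: XY.
Qed.

Lemma eq_comb X d f g : f =1 g -> comb X d g -> comb X d f.
Proof. by move=> /funext ->. Qed.

Lemma comb_brk (X Y Z : int -> series M -> Prop) d e f g :
  (forall q q' l l', X q l -> Y q' l' -> Z (q + q') (brk q q' l l')) ->
  comb X d f -> comb Y e g -> comb Z (d + e) (brk d e f g).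
Proof.
move=> XYZ hf hg; elim: hf => [|p q c l {}f cp Xl <- _ IHf].
  by apply: eq_comb (comb0 _ _) => s; exact: brk0l.
apply: eq_comb; first by move=> s; exact: brk_linl.
apply: combD IHf; rewrite -addrA; apply: combZ => //.
elim: hg => [|p' q' c' l' {}g cp' Yl' <- _ IHg].
  by apply: eq_comb (comb0 _ _) => s; exact: brk0r.
apply: eq_comb; first by move=> s; exact: brk_linr.
apply: combD IHg; rewrite addrCA; apply: combZ => //.
by apply: comb1; exact: XYZ.
Qed.

(** The closure of the combinations of X for pointwise convergence. *)
Definition approx (X : int -> series M -> Prop) d f : Prop :=
  forall S : seq (seq M), exists2 g, comb X d g & {in S, f =1 g}.

Lemma comb_approx X d f : comb X d f -> approx X d f.
Proof. by move=> hf S; exists f. Qed.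

Lemma approx1 (X : int -> series M -> Prop) d l : X d l -> approx X d l.
Proof. by move=> /comb1/comb_approx. Qed.

Lemma approxD X d f g : approx X d f -> approx X d g ->
  approx X d (fun s => f s + g s).
Proof.
move=> hf hg S; have [f' cf ef] := hf S; have [g' cg eg] := hg S.
by exists (fun s => f' s + g' s); [exact: combD|move=> s sS; rewrite ef ?eg].
Qed.

Lemma approxZ X d f i (a : K) : gf_gr i a -> approx X d f ->
  approx X (i + d) (fun s => a * f s).
Proof.
move=> ai hf S; have [f' cf ef] := hf S.
by exists (fun s => a * f' s); [exact: combZ|move=> s sS; rewrite ef].
Qed.

(** If M is free, this turns out to be the completed free Lie algebra.  Unlike
    convergence of a family of terms, it is visibly stable under limits. *)
Definition closL := approx (@lie_monomial K M).

Lemma closL_lie d l : lie_monomial d l -> closL d l.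
Proof. exact: approx1. Qed.

Lemma closLN d f : closL d f -> closL d (fun s => - f s).
Proof.
move=> hf; under eq_fun do rewrite -mulN1r.
rewrite -[d]add0r; apply: approxZ => //.
by apply: (grN (gf_grading K)); exact: gf_one.
Qed.

Lemma closLB d f g : closL d f -> closL d g -> closL d (fun s => f s - g s).
Proof. by move=> hf hg; apply: approxD => //; exact: closLN. Qed.

Lemma closL_brk d e f g : closL d f -> closL e g -> closL (d + e) (brk d e f g).
Proof.
move=> hf hg S; have [f' cf ef] := hf (factors S).
have [g' cg eg] := hg (factors S).
exists (brk d e f' g'); last exact: eq_brk.
by apply: comb_brk cf cg => *; exact: lie_brk.
Qed.

Lemma comb_hatT d f : comb (@lie_monomial K M) d f -> hatT d f.
Proof.
elim=> [|p q c l {}f cp Xl pq _ IH]; first exact: hatT0.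
exact: (hatT_lin cp pq (hatT_lie Xl) IH).
Qed.

Lemma closL_hatT d f : closL d f -> hatT d f.
Proof.
move=> hf; split=> [s t a x y|s i si].
  have [g /comb_hatT[mg _] eg] := hf [:: s ++ (a *: x + y) :: t;
    s ++ x :: t; s ++ y :: t].
  by rewrite !eg ?inE ?eqxx ?orbT.
have [g /comb_hatT[_ dg] eg] := hf [:: s].
by rewrite eg ?inE //; exact: dg.
Qed.

Lemma comb_nil d f : comb (@lie_monomial K M) d f -> f [::] = 0.
Proof.
by elim=> // p q c l {}f _ /lie_nil-> _ _ ->; rewrite mulr0 addr0.
Qed.

Lemma closL_nil d f : closL d f -> f [::] = 0.
Proof.
by move=> hf; have [g /comb_nil g0 ->] := hf [:: [::]]; rewrite ?inE.
Qed.

(** On finitely many words only finitely many terms of a convergent family are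
    nonzero. *)
Lemma hatL_closL d f : hatL d f -> closL d f.
Proof.
move=> [_ [I [c [l [p [q [h fE]]]]]]] S.
have [A uA AP] : exists2 A : seq I, uniq A &
    forall s (k : I), s \in S -> k \notin A -> c k * l k s = 0.
  elim: S => [|s S [A uA AP]]; first by exists [::].
  have [B uB BP] := finite_set_uniq_seq (fE s).1.
  exists (undup (A ++ B)); first exact: undup_uniq.
  move=> t k; rewrite inE mem_undup mem_cat negb_or => /orP[/eqP->|tS] /andP[iA iB].
    by apply/eqP; apply: contraNT iB => ci; apply/BP.
  exact: AP.
exists (fun s => \sum_(k <- A) c k * l k s); last first.
  by move=> s sS; rewrite (fE s).2 (finsum_seq uA) // => k; exact: AP.
elim: A {uA AP} => [|k A IH].
  by apply: eq_comb (comb0 _ _) => s; rewrite big_nil.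
apply: eq_comb; first by move=> s; rewrite big_cons.
by have [cp lq pq] := h k; exact: (combS cp lq pq IH).
Qed.

Definition is_brk q l : Prop := exists d e f g,
  [/\ lie_monomial d f, lie_monomial e g, q = d + e & l = brk d e f g].

Lemma brk_letter d e f g v : f [::] = 0 -> g [::] = 0 -> brk d e f g [:: v] = 0.
Proof.
move=> f0 g0; rewrite /brk !conv_cons !conv_nil f0 g0.
by rewrite !mul0r !mulr0 addr0 mulr0 subrr.
Qed.

(** All words on which a Lie monomial is nonzero have the same length, so the
    generators in an approximation of f only contribute to letters, where f
    vanishes, and can be dropped. *)
Lemma closL_brackets d f : closL d f -> (forall v, f [:: v] = 0) ->
  approx is_brk d f.
Proof.
move=> hf f1 S; have [g cg eg] := hf S.
have [g' cg' [eg' g1]] : exists2 g', comb is_brk d g' &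
    (forall s, size s != 1%N -> g s = g' s) /\ (forall v, g' [:: v] = 0).
  elim: cg {hf f1 eg} => [|p q c l {}f cp ll pq _ [g' cg' [eg' g1]]].
    by exists (fun=> 0); first exact: comb0.
  case: ll cp pq => [{}q a da|q1 q2 f1 f2 h1 h2] cp pq.
    exists g' => //; split=> // s s1; rewrite -eg' //.
    by case: s s1 => [|v [|? ?]] //= _; rewrite mulr0 add0r.
  exists (fun s => c * brk q1 q2 f1 f2 s + g' s).
    by apply: (combS cp _ pq cg'); exists q1, q2, f1, f2.
  split=> [s s1|v]; first by rewrite eg'.
  by rewrite g1 brk_letter ?mulr0 ?addr0 //; [exact: lie_nil h1|exact: lie_nil h2].
exists g' => // s sS; have [s1|s1] := eqVneq (size s) 1%N.
  by case: s s1 {sS} => [|v [|]] // _; rewrite f1 g1.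
by rewrite eg // eg'.
Qed.

(** The sign (-1)^d of a functional of degree d can be moved to its argument, as
    a(v) is nonzero only for v of the parity of d.  With such an involution eps,
    Koszul signs become formulas on words that do not mention degrees. *)
Definition is_parity (eps : M -> M) : Prop :=
  forall d (a : {scalar M}), dual_deg d a -> forall v, a (eps v) = sgn K d * a v.

Lemma conv_parity (eps : M -> M) d e f g s :
  (forall s, f (map eps s) = sgn K d * f s) ->
  (forall s, g (map eps s) = sgn K e * g s) ->
  conv f g (map eps s) = sgn K (d + e) * conv f g s.
Proof.
move=> hf hg; rewrite /conv size_map mulr_sumr; apply: eq_bigr => k _.
by rewrite -map_take -map_drop hf hg sgnD mulrACA.
Qed.

Lemma closL_parity eps d f s : is_parity eps -> closL d f ->
  f (map eps s) = sgn K d * f s.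
Proof.
move=> heps /(_ [:: s; map eps s])[g cg eg]; rewrite !eg ?inE ?eqxx ?orbT // => {eg}.
elim: cg => [|p q c l {}f cp ll pq _ IH]; first by rewrite mulr0.
rewrite IH mulrDr -pq; congr (_ + _).
rewrite mulrA (sgn_scal _ cp) -mulrA mulrCA; congr (_ * _).
elim: ll s {IH pq} => {}q => [a da|e f1 f2 _ h1 _ h2] s.
  by case: s => [|v [|? ?]] /=; rewrite ?mulr0 // (heps q).
rewrite /brk (conv_parity s h1 h2) (conv_parity s h2 h1) [e + q]addrC.
by rewrite mulrBr; congr (_ - _); rewrite mulrCA.
Qed.

End Words.

(** * Homogeneous bases, and the completed free Lie algebra as a closure *)

(** A homogeneous basis e with its dual basis co of coordinate functions. *)
Record coords (K : gradedField) (M : gradedModule K) := Coords {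
  cB : choiceType;
  ce : cB -> M;
  cdeg : cB -> int;
  cco : cB -> {scalar M};
  ce_deg : forall b, gm_gr (cdeg b) (ce b);
  cco_deg : forall b, dual_deg (- cdeg b) (cco b);
  cco_ce : forall b b', cco b (ce b') = (b == b')%:R;
  cco_seq : forall v, exists L : seq cB, [/\ uniq L,
    forall b, b \notin L -> cco b v = 0 & v = \sum_(b <- L) cco b v *: ce b] }.

(** Linear forms are built from functions that are only known to exist, hence the
    packing by hand. *)
Lemma scalar_of (K : nzRingType) (M : lmodType K) (f : M -> K) :
  (forall a x y, f (a *: x + y) = a * f x + f y) ->
  exists a : {scalar M}, a =1 f.
Proof.
move=> hf; pose h : GRing.isLinear K M K *%R f := GRing.isLinear.Build _ _ _ _ f hf.
by exists (HB.pack f h : {scalar M}).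
Qed.

Section Coordinates.
Variables (K : gradedField) (M : gradedModule K).

Lemma graded_free_coords : graded_free M -> inhabited (coords M).
Proof.
case=> B [e [deg [edeg ebas]]].
pose co (v : M) : B -> K := projT1 (cid (ebas v)).
have coP v : finite_set [set b | co v b != 0] /\ v = \sum_(b \in setT) co v b *: e b.
  by rewrite /co; case: cid => c [].
have co_uniq v c (A : seq B) : uniq A -> (forall b, b \notin A -> c b = 0) ->
    v = \sum_(b <- A) c b *: e b -> co v = c.
  move=> uA c0 vE; rewrite /co; case: cid => c' /= [_]; apply; split.
    apply: (@uniq_seq_finite_set _ _ A) => b /=; apply: contraR => bA.
    by rewrite c0.
  by rewrite (@finsum_seq _ _ A) // => b bA; rewrite c0 // scale0r.
have co_seq v : exists L : seq B, [/\ uniq L,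
    forall b, b \notin L -> co v b = 0 & v = \sum_(b <- L) co v b *: e b].
  have [fin vE] := coP v; have [L uL LP] := finite_set_uniq_seq fin.
  have L0 b : b \notin L -> co v b = 0.
    by move=> bL; apply/eqP; apply: contraNT bL => cb; apply/LP.
  exists L; split=> //; rewrite {1}vE (@finsum_seq _ _ L) // => b bL.
  by rewrite L0 // scale0r.
have co_wide v (A : seq B) : uniq A -> (forall b, b \notin A -> co v b = 0) ->
    v = \sum_(b <- A) co v b *: e b.
  move=> uA A0; rewrite {1}(coP v).2 (@finsum_seq _ _ A) // => b bA.
  by rewrite A0 // scale0r.
have co_lin a x y : co (a *: x + y) = fun b => a * co x b + co y b.
  have [Lx [ux x0 _]] := co_seq x; have [Ly [uy y0 _]] := co_seq y.
  have sub v (L L' : seq B) : {subset L <= L'} ->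
    (forall b, b \notin L -> co v b = 0) -> forall b, b \notin L' -> co v b = 0.
    by move=> LL' L0 b bL'; apply: L0; apply: contra bL'; exact: LL'.
  have x0' : forall b, b \notin undup (Lx ++ Ly) -> co x b = 0.
    by apply: sub x0 => b; rewrite mem_undup mem_cat => ->.
  have y0' : forall b, b \notin undup (Lx ++ Ly) -> co y b = 0.
    by apply: sub y0 => b; rewrite mem_undup mem_cat orbC => ->.
  apply: (co_uniq _ _ (undup (Lx ++ Ly))); first exact: undup_uniq.
    by move=> b bL; rewrite x0' // y0' // mulr0 addr0.
  rewrite {1}(co_wide _ _ (undup_uniq _) x0') {1}(co_wide _ _ (undup_uniq _) y0').
  rewrite scaler_sumr -big_split; apply: eq_bigr => b _ /=.
  by rewrite scalerDl scalerA.
have /choice[f fP] : forall b, exists a : {scalar M}, a =1 co^~ b.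
  by move=> b; apply: scalar_of => a x y; rewrite co_lin.
have VP := gm_grading M; have KP := gf_grading K.
(* Taking components of degree i in v = sum_b co_b(v) e_b shows that the
   coordinates of a homogeneous vector are homogeneous. *)
have co_homog i v b : gm_gr i v -> gf_gr (i - deg b) (co v b).
  move=> vi; have [L [uL L0 vE]] := co_seq v.
  have hZ (a : K) b' : hcomp (@gm_gr _ M) i (a *: e b') =
      hcomp (@gf_gr K) (i - deg b') a *: e b'.
    have [A [uA A0 aE]] := hcomp_seq KP a.
    have gA j : gm_gr (j + deg b') (hcomp (@gf_gr K) j a *: e b').
      by apply: gm_scale => //; exact: gr_hcomp.
    rewrite {1}aE scaler_suml hcomp_sum //.
    case: (boolP (i - deg b' \in A)) => iA.
      rewrite (bigD1_seq (i - deg b')) //= big1 ?addr0 => [|j ji].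
        by apply: hcomp_id => //; have := gA (i - deg b'); rewrite subrK.
      apply: (hcomp_neq VP (gA j)); apply: contra ji => /eqP ->.
      by rewrite addrK.
    rewrite A0 // scale0r big_seq big1 // => j jA.
    apply: (hcomp_neq VP (gA j)); apply: contra iA => /eqP ->.
    by rewrite addrK.
  have e1 : v = \sum_(b' <- L) hcomp (@gf_gr K) (i - deg b') (co v b') *: e b'.
    rewrite -{1}(hcomp_id VP vi) {1}vE hcomp_sum //.
    by apply: eq_bigr => b' _; exact: hZ.
  have -> : co v = fun b' => hcomp (@gf_gr K) (i - deg b') (co v b').
    by apply: (co_uniq _ _ L uL _ e1) => b' /L0 ->; rewrite hcomp_zero.
  exact: gr_hcomp.
constructor; apply: (@Coords _ _ B e deg f) => //.
- by move=> b i v vi; rewrite fP addrC; exact: co_homog.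
- move=> b b'; rewrite fP; suff -> : co (e b') = fun b => (b == b')%:R by [].
  apply: (co_uniq _ _ [:: b']) => //.
    by move=> b0; rewrite inE => /negbTE ->.
  by rewrite big_seq1 eqxx scale1r.
- move=> v; have [L [uL L0 vE]] := co_seq v; exists L; split=> //.
    by move=> b bL; rewrite fP L0.
  by rewrite {1}vE; apply: eq_bigr => b _; rewrite fP.
Qed.

Variable cM : coords M.
Local Notation e := (@ce _ _ cM).
Local Notation co := (@cco _ _ cM).

Lemma coords_graded_free : graded_free M.
Proof.
exists (cB cM), e, (@cdeg _ _ cM); split=> [b|v]; first exact: ce_deg.
have [L [uL L0 vE]] := cco_seq cM v.
exists (co^~ v); split=> [|c [fin ->]]; first split.
- apply: (@uniq_seq_finite_set _ _ L) => b /=; apply: contraR => bL.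
  by rewrite L0.
- rewrite {1}vE (@finsum_seq _ _ L) // => b bL; by rewrite L0 // scale0r.
have [L' uL' L'P] := finite_set_uniq_seq fin.
have c0 b : b \notin L' -> c b = 0.
  by move=> bL; apply/eqP; apply: contraNT bL => cb; apply/L'P.
apply/funext => b; rewrite (@finsum_seq _ _ L') //; last first.
  by move=> b' bL'; rewrite c0 // scale0r.
rewrite linear_sum /=; under eq_bigr do rewrite linearZ /= cco_ce.
case: (boolP (b \in L')) => bL.
  rewrite (bigD1_seq b) //= eqxx mulr1 big1 ?addr0 // => b' /negbTE bb'.
  by rewrite eq_sym bb' mulr0.
rewrite c0 // big_seq big1 // => b' b'L; case: eqP => [bb'|]; last by rewrite mulr0.
by rewrite bb' b'L in bL.
Qed.

Lemma cco_sep x y : (forall b, co b x = co b y) -> x = y.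
Proof.
move=> xy; apply/eqP; rewrite -subr_eq0; apply/eqP.
have [L [_ _ ->]] := cco_seq cM (x - y).
by rewrite big1 // => b _; rewrite linearB /= xy subrr scale0r.
Qed.

Lemma dual_sep x y :
  (forall d (a : {scalar M}), dual_deg d a -> a x = a y) -> x = y.
Proof. by move=> xy; apply: cco_sep => b; apply: (xy (- cdeg b)); exact: cco_deg. Qed.

Lemma mlin_cons (f : series M) v : multilinear f -> multilinear (fun t => f (v :: t)).
Proof. by move=> mf s t a x y; exact: (mf (v :: s)). Qed.

Lemma mlin_sum (f : series M) (L : seq (cB cM)) (c : cB cM -> K) t :
  multilinear f ->
  f ((\sum_(b <- L) c b *: e b) :: t) = \sum_(b <- L) c b * f (e b :: t).
Proof.
move=> mf; have mf0 := mf [::] t; elim: L => [|b L IH]; last first.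
  by rewrite !big_cons -IH; exact: mf0.
rewrite !big_nil; have := mf0 1 0 0; rewrite scale1r addr0 mul1r /= => h.
by apply: (addrI (f (0 :: t))); rewrite addr0.
Qed.

Lemma mlin_expand (y : seq M) : exists L : seq (K * seq (cB cM)),
  forall f : series M, multilinear f -> f y = \sum_(x <- L) x.1 * f (map e x.2).
Proof.
elim: y => [|v y [L LP]].
  by exists [:: (1, [::])] => f _; rewrite big_seq1 mul1r.
have [A [_ _ vE]] := cco_seq cM v.
exists [seq (co b v * x.1, b :: x.2) | b <- A, x <- L] => f mf.
rewrite big_allpairs_dep {1}vE mlin_sum //; apply: eq_bigr => b _.
rewrite (LP _ (mlin_cons _ mf)) mulr_sumr; apply: eq_bigr => x _ /=.
by rewrite mulrA.
Qed.

(** The monomials whose expansion in the dual basis involves only rearrangements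
    of the word mu.  A given word of M meets only finitely many such classes,
    which makes families of pure monomials summable. *)
Definition pure (mu : seq (cB cM)) (q : int) (l : series M) : Prop :=
  lie_monomial q l /\ forall b, l (map e b) != 0 -> perm_eq b mu.

Lemma pure_brk mu nu q q' l l' : pure mu q l -> pure nu q' l' ->
  pure (mu ++ nu) (q + q') (brk q q' l l').
Proof.
move=> [hl pl] [hl' pl']; split=> [|b]; first exact: lie_brk.
have key (f g : series M) (m n : seq (cB cM)) :
    (forall b, f (map e b) != 0 -> perm_eq b m) ->
    (forall b, g (map e b) != 0 -> perm_eq b n) ->
    ~~ perm_eq b (m ++ n) -> conv f g (map e b) = 0.
  move=> pf pg /negP bmn; rewrite /conv big1 // => k _.
  rewrite -map_take -map_drop; apply/eqP; apply: contraT => fg0; case: bmn.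
  rewrite -(cat_take_drop k b); apply: perm_cat.
    by apply: pf; apply: contra fg0 => /eqP ->; rewrite mul0r.
  by apply: pg; apply: contra fg0 => /eqP ->; rewrite mulr0.
apply: contraR => nb; rewrite /brk (key l l' mu nu) // (key l' l nu mu) //.
  by rewrite mulr0 subrr.
by rewrite perm_sym perm_catC perm_sym.
Qed.

(** On words in the finite alphabet A, a generator a may be replaced by the finite
    sum of the a(e_b) e_b^* with b in A; brackets are then expanded bilinearly. *)
Lemma lie_pure (A : seq (cB cM)) q l : lie_monomial q l ->
  exists2 g, comb (fun q l => exists mu, pure mu q l) q g &
    forall b, {subset b <= A} -> l (map e b) = g (map e b).
Proof.
elim=> {q l} [q a qa|d1 d2 f1 f2 _ [g1 cg1 eg1] _ [g2 cg2 eg2]].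
  exists (fun s => \sum_(b <- undup A) a (e b) * gen (co b) s).
    elim: (undup A) => [|b L IH].
      by apply: eq_comb (comb0 _ _) => s; rewrite big_nil.
    apply: eq_comb; first by move=> s; rewrite big_cons.
    apply: (combS (q := - @cdeg _ _ cM b) (qa _ _ (ce_deg b)) _ _ IH);
      last by rewrite addrK.
    exists [:: b]; split=> [|b']; first by apply: lie_gen; exact: cco_deg.
    case: b' => [|b1 [|? ?]] /=; rewrite ?eqxx //.
    by rewrite cco_ce; case: (eqVneq b b1) => [->|]; rewrite ?eqxx.
  case=> [|b [|? ?]] bA /=; try by rewrite big1 // => ? _; rewrite mulr0.
  rewrite (bigD1_seq b) ?undup_uniq ?mem_undup ?bA ?inE //= cco_ce eqxx mulr1.
  rewrite big1 ?addr0 // => b' bb'; by rewrite cco_ce (negbTE bb') mulr0.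
exists (brk d1 d2 g1 g2).
  apply: comb_brk cg1 cg2 => q q' l l' [mu hm] [nu hn].
  by exists (mu ++ nu); exact: pure_brk.
move=> b bA; have bt k : {subset take k b <= A} by move=> x /mem_take; exact: bA.
have bd k : {subset drop k b <= A} by move=> x /mem_drop; exact: bA.
by rewrite /brk; congr (_ - _ * _); apply: eq_conv => k;
  rewrite -?map_take -?map_drop ?eg1 ?eg2.
Qed.

(** The rearrangements of mu are finite in number, and a pure monomial that belongs
    to another class vanishes on all of them. *)
Lemma closL_pure d f mu : closL d f ->
  exists2 g, comb (pure mu) d g &
    forall b, perm_eq b mu -> f (map e b) = g (map e b).
Proof.
move=> /(_ [seq map e b | b <- permutations mu])[g cg eg].
have [g' cg' eg'] : exists2 g', comb (fun q l => exists mu, pure mu q l) d g' &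
    forall b, {subset b <= mu} -> g (map e b) = g' (map e b).
  elim: cg {eg} => [|p q c l {}f cp ll pq _ [g' cg' eg']].
    by exists (fun=> 0); first exact: comb0.
  have [l' cl' el'] := lie_pure mu ll.
  exists (fun s => c * l' s + g' s); last by move=> b bm; rewrite el' ?eg'.
  by apply: combD cg'; rewrite -pq; exact: combZ.
have [h ch eh] : exists2 h, comb (pure mu) d h &
    forall b, perm_eq b mu -> g' (map e b) = h (map e b).
  elim: cg' {eg'} => [|p q c l {g' eg}f cp [nu [ll pl]] pq _ [h ch eh]].
    by exists (fun=> 0); first exact: comb0.
  case: (boolP (perm_eq mu nu)) => mn.
    exists (fun s => c * l s + h s); last by move=> b bm; rewrite eh.
    apply: (combS cp _ pq ch); split=> // b /pl bn.
    by rewrite (perm_trans bn) // perm_sym.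
  exists h => // b bm; rewrite eh //; case: (eqVneq (l (map e b)) 0) => [->|/pl bn].
    by rewrite mulr0 add0r.
  by case/negP: mn; rewrite perm_sym in bm; exact: perm_trans bm bn.
exists h => // b bm; rewrite -eh // -eg' => [|x]; last by rewrite (perm_mem bm).
by apply: eg; apply/mapP; exists b => //; rewrite mem_permutations.
Qed.

(** Indexing by all natural numbers, with zero coefficients from n on, lets the
    families of all classes mu share one index type; l0 fills the places that are
    left. *)
Lemma comb_family (X : int -> series M -> Prop) d f l0 : X d l0 -> comb X d f ->
  exists x : nat * (nat -> K) * (nat -> series M) * (nat -> int) * (nat -> int),
    let: (n, c, l, p, q) := x in
    [/\ forall k, [/\ gf_gr (p k) (c k), X (q k) (l k) & p k + q k = d],
        forall k, (n <= k)%N -> c k = 0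
      & forall s, f s = \sum_(0 <= k < n) c k * l k s].
Proof.
move=> Xl0; elim=> [|p q c l {}f cp Xl pq _ [[[[[n cs] ls] ps] qs]] [h1 h2 h3]].
  exists (0%N, fun=> 0, fun=> l0, fun=> 0, fun=> d); split=> [k|//|s].
    by split=> //; [exact: (gr0 (gf_grading K))|rewrite add0r].
  by rewrite big_geq.
pose cn T (x : T) (u : nat -> T) k := if k is k'.+1 then u k' else x.
exists (n.+1, cn _ c cs, cn _ l ls, cn _ p ps, cn _ q qs); split=> [[|k]|[|k]|s] //=.
- by move=> nk; exact: h2.
- by rewrite big_nat_recl // h3.
Qed.

(** Choosing a representative of each class of words up to rearrangement avoids
    ordering the basis. *)
Definition content (b : seq (cB cM)) : seq (cB cM) := choose (perm_eq b) b.

Lemma perm_content b : perm_eq b (content b).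
Proof. by apply: chooseP; exact: perm_refl. Qed.

Lemma eq_content b b' : perm_eq b b' -> content b = content b'.
Proof.
move=> bb'; rewrite /content (eq_choose (permPl bb')).
by apply: choose_id; rewrite // perm_sym.
Qed.

(** The completed free Lie algebra is closed in the topology of pointwise
    convergence: sorting the words in the basis by their content splits a limit
    of combinations of Lie monomials into finite combinations of pure ones. *)
Lemma closL_hatL d (f : series M) : closL d f -> hatL d f.
Proof.
move=> hf; split; first exact: closL_hatT.
have pure0 mu : pure mu d (gen (\0 : {scalar M})).
  split=> [|b]; last by case: b => [|? [|? ?]] /=; rewrite eqxx.
  by apply: lie_gen => i v _; exact: (gr0 (gf_grading K)).
have /choice[F FP] : forall mu, exists x : nat * (nat -> K) * (nat -> series M) *
    (nat -> int) * (nat -> int), let: (n, c, l, p, q) := x in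
    [/\ forall k, [/\ gf_gr (p k) (c k), pure mu (q k) (l k) & p k + q k = d],
        forall k, (n <= k)%N -> c k = 0
      & forall b, perm_eq b mu ->
          f (map e b) = \sum_(0 <= k < n) c k * l k (map e b)].
  move=> mu; have [g cg eg] := closL_pure mu hf.
  have [[[[[n c] l] p] q] [h1 h2 h3]] := comb_family (pure0 mu) cg.
  by exists (n, c, l, p, q); split=> // b bm; rewrite eg.
pose n mu := (F mu).1.1.1.1; pose c mu := (F mu).1.1.1.2.
pose l mu := (F mu).1.1.2; pose p mu := (F mu).1.2; pose q mu := (F mu).2.
have {}FP mu : [/\ forall k, [/\ gf_gr (p mu k) (c mu k),
      pure mu (q mu k) (l mu k) & p mu k + q mu k = d],
    forall k, (n mu <= k)%N -> c mu k = 0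
    & forall b, perm_eq b mu ->
      f (map e b) = \sum_(0 <= k < n mu) c mu k * l mu k (map e b)].
  by rewrite /n /c /l /p /q; case: (F mu) (FP mu) => [[[[? ?] ?] ?] ?].
clearbody n c l p q.
exists (seq (cB cM) * nat)%type.
exists (fun i => if content i.1 == i.1 then c i.1 i.2 else 0).
exists (fun i => l i.1 i.2), (fun i => p i.1 i.2), (fun i => q i.1 i.2).
split=> [[mu k]|s] /=.
  have [h _ _] := FP mu; have [cp [ll _] pq] := h k; split=> //.
  by case: eqP => // _; exact: (gr0 (gf_grading K)).
have [L LP] := mlin_expand s.
pose keys := undup [seq content x.2 | x <- L].
pose A := [seq (mu, k) | mu <- keys, k <- iota 0 (n mu)].
have uA : uniq A.
  apply: allpairs_uniq_dep => [|mu _|]; [exact: undup_uniq|exact: iota_uniq|].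
  by move=> [mu k] [mu' k'] _ _ /= [-> ->].
pose t (i : seq (cB cM) * nat) s :=
  (if content i.1 == i.1 then c i.1 i.2 else 0) * l i.1 i.2 s.
have t0 b mu k : mu != content b -> t (mu, k) (map e b) = 0.
  move=> mb; rewrite /t /=; case: eqP => [cm|]; last by rewrite mul0r.
  have [h _ _] := FP mu; have [_ [_ pl] _] := h k.
  case: (eqVneq (l mu k (map e b)) 0) => [->|/pl/eq_content bm]; first by rewrite mulr0.
  by rewrite -cm bm eqxx in mb.
have tL i : t i s = \sum_(x <- L) x.1 * t i (map e x.2).
  case: i => mu k; have [h _ _] := FP mu; have [_ [/hatT_lie[ml _] _] _] := h k.
  rewrite /t (LP _ ml) mulr_sumr; apply: eq_bigr => x _ /=; exact: mulrCA.
have A0 i : i \notin A -> t i s = 0.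
  case: i => mu k ikA; rewrite tL big_seq big1 // => x xL.
  case: (eqVneq mu (content x.2)) => [mx|/t0->]; last by rewrite mulr0.
  rewrite /t /=; have [kn|nk] := ltnP k (n mu); last first.
    have [_ h _] := FP mu; rewrite h //; by case: eqP => _; rewrite !mul0r mulr0.
  case/negP: ikA; apply/allpairsPdep; exists mu, k; split=> //.
    by rewrite mem_undup mx; apply/mapP; exists x.
  by rewrite mem_iota.
split.
  apply: (@uniq_seq_finite_set _ _ A) => i /=; apply: contraR => iA.
  by apply/eqP; exact: (A0 i iA).
rewrite (finsum_seq uA A0); have [mf _] := closL_hatT hf.
have -> : \sum_(i <- A) (if content i.1 == i.1 then c i.1 i.2 else 0) * l i.1 i.2 s =
    \sum_(x <- L) x.1 * \sum_(i <- A) t i (map e x.2).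
  under [RHS]eq_bigr do rewrite mulr_sumr.
  by rewrite exchange_big; apply: eq_bigr => i _; exact: tL.
rewrite (LP _ mf) !big_seq; apply: eq_bigr => x xL; congr (_ * _).
rewrite /A big_allpairs_dep /= (bigD1_seq (content x.2)) ?undup_uniq //=; last first.
  by rewrite mem_undup; apply/mapP; exists x.
rewrite [X in _ + X]big1 ?addr0 => [|mu mx]; last first.
  by rewrite big1 // => k _; exact: t0.
have [_ _ ->] := FP (content x.2); last exact: perm_content.
rewrite /index_iota subn0; apply: eq_bigr => k _; rewrite /t /=.
by rewrite (@eq_content (content x.2) x.2) ?eqxx // perm_sym perm_content.
Qed.

End Coordinates.

(** * Morphisms and derivations as transposes of maps of words *)

(** Transpose of a map sending each word of N to a sum of words of M. *)
Definition pull (M N : Type) (Z : nmodType) (A : seq N -> seq (seq M))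
  (f : seq M -> Z) : seq N -> Z := fun w => \sum_(s <- A w) f s.

Section Pull.
Variables (K : gradedField) (M N : gradedModule K) (A : seq N -> seq (seq M)).

Lemma pull_lin (c : K) (l f : series M) w :
  pull A (fun s => c * l s + f s) w = c * pull A l w + pull A f w.
Proof. by rewrite /pull mulr_sumr -big_split. Qed.

Lemma pull_local (f g : series M) w : {in A w, f =1 g} -> pull A f w = pull A g w.
Proof. by move=> fg; rewrite /pull !big_seq; apply: eq_bigr => s /fg. Qed.

(** The value of pull A f at a word depends on finitely many values of f, so that it
    suffices to treat Lie monomials. *)
Lemma pull_approx p :
  (forall q l, lie_monomial q l -> closL (q + p) (pull A l)) ->
  forall d (f : series M), closL d f -> closL (d + p) (pull A f).
Proof.
move=> hA d f hf S; have [g cg eg] := hf (flatten (map A S)).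
suff /(_ S)[h ch eh] : closL (d + p) (pull A g).
  exists h => // w wS; rewrite -eh //; apply: pull_local => s sA; apply: eg.
  by apply/flatten_mapP; exists w.
elim: cg {eg} => [|r q c l {hf}f cr ll rq _ IH].
  have -> : pull A (fun=> 0 : K) = fun=> 0 by apply/funext => w; rewrite /pull big1.
  by apply: comb_approx; exact: comb0.
have -> : pull A (fun s => c * l s + f s) = fun w => c * pull A l w + pull A f w.
  by apply/funext => w; exact: pull_lin.
apply: (approxD _ IH); rewrite -rq -addrA; apply: approxZ => //; exact: hA.
Qed.

End Pull.

Section Morphism.
Variables (K : gradedField) (M N : gradedModule K) (F : seq N -> M).

(** All ways to cut a word into nonempty blocks, each replaced by its image under
    F: the morphism of tensor coalgebras with corestriction F.  The block u is
    still being read, which makes the recursion structural. *)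
Fixpoint blocksR (u w : seq N) : seq (seq M) :=
  if w is x :: w' then
    blocksR (rcons u x) w' ++ [seq F u :: s | s <- blocksR [:: x] w']
  else [:: [:: F u]].

Definition blocks (w : seq N) : seq (seq M) :=
  if w is x :: w' then blocksR [:: x] w' else [:: [::]].

Lemma sum_blocks_cons (Z : nmodType) (f : seq M -> Z) u x w :
  \sum_(s <- blocksR u (x :: w)) f s =
  \sum_(s <- blocksR (rcons u x) w) f s +
  \sum_(s <- blocksR [:: x] w) f (F u :: s).
Proof. by rewrite /= big_cat big_map. Qed.

(** Deconcatenation of the word of blocks: either the cut is at its beginning, or it
    comes after a block that ends at position k of w. *)
Lemma blocksR_conv (f g : series M) u w :
  \sum_(s <- blocksR u w) conv f g s =
  f [::] * (\sum_(s <- blocksR u w) g s) +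
  \sum_(k < (size w).+1)
    (\sum_(s <- blocksR u (take k w)) f s) * pull blocks g (drop k w).
Proof.
elim: w u f => [|x w IH] u f.
  rewrite big_ord1 /pull /= !big_seq1 /conv !big_ord_recl big_ord0 /=.
  by rewrite addr0.
rewrite !sum_blocks_cons IH.
have -> : \sum_(s <- blocksR [:: x] w) conv f g (F u :: s) =
    f [::] * (\sum_(s <- blocksR [:: x] w) g (F u :: s)) +
    \sum_(s <- blocksR [:: x] w) conv (fun t => f (F u :: t)) g s.
  by rewrite mulr_sumr -big_split; apply: eq_bigr => s _; rewrite conv_cons.
rewrite IH [X in _ = _ + X]big_ord_recl take0 drop0 [blocksR u [::]]/= big_seq1.
rewrite [pull _ g (x :: w)]/pull [blocks (x :: w)]/=.
rewrite [X in _ = _ + (_ + X)](_ : _ =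
  \sum_(k < (size w).+1)
    (\sum_(s <- blocksR (rcons u x) (take k w)) f s) * pull blocks g (drop k w) +
  \sum_(k < (size w).+1)
    (\sum_(s <- blocksR [:: x] (take k w)) f (F u :: s)) * pull blocks g (drop k w)).
  by ring.
by rewrite -big_split; apply: eq_bigr => k _; rewrite [RHS]/= -mulrDl -sum_blocks_cons.
Qed.

Lemma pull_blocks_conv (f g : series M) w :
  pull blocks (conv f g) w = conv (pull blocks f) (pull blocks g) w.
Proof.
case: w => [|x w]; first by rewrite conv_nil /pull !big_seq1 conv_nil.
by rewrite conv_cons [LHS]blocksR_conv /pull big_seq1.
Qed.

Lemma pull_blocks_brk d e (f g : series M) :
  pull blocks (brk d e f g) = brk d e (pull blocks f) (pull blocks g).
Proof.
apply/funext => w; rewrite /brk -!pull_blocks_conv /pull mulr_sumr -sumrB.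
by apply: eq_bigr.
Qed.

Lemma blocksR_neq0 u w s : s \in blocksR u w -> s != [::].
Proof.
elim: w u => [|x w IH] u /=; first by rewrite inE => /eqP ->.
by rewrite mem_cat => /orP[/IH//|/mapP[t _ ->]].
Qed.

Lemma sum_blocksR_gen (a : {scalar M}) u w :
  \sum_(s <- blocksR u w) gen a s = a (F (u ++ w)).
Proof.
elim: w u => [|x w IH] u; first by rewrite big_seq1 cats0.
rewrite sum_blocks_cons IH cat_rcons [X in _ + X]big_seq big1 ?addr0 // => s.
by move/blocksR_neq0; case: s.
Qed.

Lemma pull_blocks_gen (a : {scalar M}) w : F [::] = 0 ->
  pull blocks (gen a) w = a (F w).
Proof.
move=> F0; case: w => [|x w]; first by rewrite F0 linear0 /pull big_seq1.
exact: sum_blocksR_gen.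
Qed.

Lemma pull_blocks_closL :
  (forall d (a : {scalar M}), dual_deg d a -> closL d (fun w => a (F w))) ->
  F [::] = 0 ->
  forall d (f : series M), closL d f -> closL d (pull blocks f).
Proof.
move=> hF F0 d f hf; rewrite -[d]addr0; apply: pull_approx hf => q l.
rewrite addr0; elim=> [{}q a qa|d1 d2 f1 f2 _ IH1 _ IH2].
  by have -> : pull blocks (gen a) = (fun w => a (F w));
    [apply/funext => w; exact: pull_blocks_gen|exact: hF].
by rewrite pull_blocks_brk; exact: closL_brk.
Qed.

End Morphism.

Section MorphismLocal.
Variables (K : gradedField) (M N : gradedModule K) (F1 F2 : seq N -> M).

Lemma eq_blocksR u w :
  (forall v, (size v <= size u + size w)%N -> F1 v = F2 v) ->
  blocksR F1 u w = blocksR F2 u w.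
Proof.
elim: w u => [|x w IH] u h /=; first by rewrite h // addn0.
rewrite !IH => [|v vs|v vs]; last first.
- by apply: h; rewrite (leq_trans vs) // size_rcons /= addnS.
- by apply: h; rewrite (leq_trans vs) //= leq_addl.
by rewrite h // leq_addr.
Qed.

(** A series without linear part only involves the values of F on proper
    subwords; this makes recursions on the length of words well founded. *)
Lemma eq_pull_blocks (Z : nmodType) (f : seq M -> Z) w :
  (forall v, (size v < size w)%N -> F1 v = F2 v) -> (forall v, f [:: v] = 0) ->
  pull (blocks F1) f w = pull (blocks F2) f w.
Proof.
case: w => [|x w] h f1; first by rewrite /pull.
rewrite /pull /=.
have : forall v, (size v < size [:: x] + size w)%N -> F1 v = F2 v by [].
have : [:: x] != [::] by [].
elim: w [:: x] {h} => [|y w IH] u u0 h; first by rewrite !big_seq1 !f1.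
rewrite !sum_blocks_cons; congr (_ + _).
  apply: IH => [|v vs]; first by case: (u).
  by apply: h; rewrite size_rcons addSn -addnS in vs.
have us : (0 < size u)%N by case: (u) u0.
rewrite h ?(@eq_blocksR [:: y] w) // => [v vs|]; last by rewrite /= addnS ltnS leq_addr.
by apply: h; rewrite (leq_ltn_trans vs) //= -[ltnLHS]add0n ltn_add2r.
Qed.

End MorphismLocal.

Section Derivation.
Variables (K : gradedField) (M : gradedModule K) (eps : M -> M) (Q : seq M -> M).

(** All ways to replace a nonempty prefix (one that extends u), respectively a
    nonempty factor, of a word by its image under Q: the coderivation with
    corestriction Q.  Applying eps to a letter gives the Koszul sign for moving
    the odd map Q past it. *)
Fixpoint prefixes (u w : seq M) : seq (seq M) :=
  if w is x :: w' then (Q u :: w) :: prefixes (rcons u x) w' else [:: [:: Q u]].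

Fixpoint slots (w : seq M) : seq (seq M) :=
  if w is x :: w' then prefixes [:: x] w' ++ [seq eps x :: s | s <- slots w']
  else [::].

Lemma sum_prefixes_cons (f : series M) u x w :
  \sum_(s <- prefixes u (x :: w)) f s =
  f (Q u :: x :: w) + \sum_(s <- prefixes (rcons u x) w) f s.
Proof. by rewrite /= big_cons. Qed.

Lemma pull_slots_cons (f : series M) x w :
  pull slots f (x :: w) =
  \sum_(s <- prefixes [:: x] w) f s + pull slots (fun s => f (eps x :: s)) w.
Proof. by rewrite /pull /= big_cat big_map. Qed.

Lemma pull_slots_nil (f : series M) : pull slots f [::] = 0.
Proof. by rewrite /pull big_nil. Qed.

Lemma prefixes_conv (f g : series M) u w :
  \sum_(s <- prefixes u w) conv f g s =
  f [::] * (\sum_(s <- prefixes u w) g s) +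
  \sum_(k < (size w).+1) (\sum_(s <- prefixes u (take k w)) f s) * g (drop k w).
Proof.
elim: w u => [|x w IH] u.
  by rewrite big_ord1 /= !big_seq1 /conv !big_ord_recl big_ord0 /= addr0.
rewrite !sum_prefixes_cons IH conv_cons [X in _ = _ + X]big_ord_recl take0 drop0.
rewrite [prefixes u [::]]/= big_seq1.
rewrite [X in _ = _ + (_ + X)](_ : _ =
  conv (fun t => f (Q u :: x :: t)) g w +
  \sum_(k < (size w).+1)
    (\sum_(s <- prefixes (rcons u x) (take k w)) f s) * g (drop k w)).
  by rewrite conv_cons; ring.
rewrite -big_split; apply: eq_bigr => k _.
by rewrite [RHS]/= -mulrDl -sum_prefixes_cons.
Qed.

Lemma pull_slots_conv (f g : series M) w :
  pull slots (conv f g) w =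
  conv (pull slots f) g w + conv (fun s => f (map eps s)) (pull slots g) w.
Proof.
elim: w f => [|x w IH] f.
  by rewrite !conv_nil !pull_slots_nil mul0r mulr0 addr0.
rewrite !conv_cons !pull_slots_cons pull_slots_nil mul0r add0r prefixes_conv.
have -> : pull slots (fun s => conv f g (eps x :: s)) w =
    f [::] * pull slots (fun s => g (eps x :: s)) w +
    pull slots (conv (fun s => f (eps x :: s)) g) w.
  by rewrite /pull mulr_sumr -big_split; apply: eq_bigr => s _; rewrite conv_cons.
rewrite IH.
have -> : conv (fun t => pull slots f (x :: t)) g w =
    \sum_(k < (size w).+1) (\sum_(s <- prefixes [:: x] (take k w)) f s) * g (drop k w) +
    conv (pull slots (fun s => f (eps x :: s))) g w.
  rewrite /conv -big_split; apply: eq_bigr => k _ /=.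
  by rewrite -mulrDl pull_slots_cons.
by rewrite /=; ring.
Qed.

Lemma prefixes_neq0 u w s : s \in prefixes u w -> s != [::].
Proof.
elim: w u => [|x w IH] u /=; first by rewrite inE => /eqP ->.
by rewrite inE => /orP[/eqP->//|/IH].
Qed.

Lemma slots_neq0 w s : s \in slots w -> s != [::].
Proof.
case: w => [|x w] //=.
by rewrite mem_cat => /orP[/prefixes_neq0//|/mapP[t _ ->]].
Qed.

Lemma pull_slots_gen (a : {scalar M}) w : Q [::] = 0 ->
  pull slots (gen a) w = a (Q w).
Proof.
move=> Q0; case: w => [|x w]; first by rewrite pull_slots_nil Q0 linear0.
rewrite pull_slots_cons [X in _ + X]/pull [X in _ + X]big_seq.
rewrite [X in _ + X]big1 ?addr0 => [|s].
  have -> : x :: w = [:: x] ++ w by [].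
  elim: w [:: x] => [|y w IH] u; first by rewrite big_seq1 cats0.
  by rewrite sum_prefixes_cons IH cat_rcons /= add0r.
by move/slots_neq0; case: s.
Qed.

Hypothesis epsP : is_parity eps.

Lemma pull_slots_brk d e (f g : series M) : closL d f -> closL e g ->
  pull slots (brk d e f g) =
  brk (d + 1) e (pull slots f) g \+ sgn K d \*o brk d (e + 1) f (pull slots g).
Proof.
move=> hf hg; apply/funext => w.
have -> : pull slots (brk d e f g) w =
    pull slots (conv f g) w - sgn K (d * e) * pull slots (conv g f) w.
  by rewrite /pull mulr_sumr -sumrB; apply: eq_bigr.
rewrite !pull_slots_conv /= /brk.
have -> : (fun s => f (map eps s)) = (fun s => sgn K d * f s + (fun=> 0) s).
  by apply/funext => s; rewrite addr0 (closL_parity _ epsP hf).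
have -> : (fun s => g (map eps s)) = (fun s => sgn K e * g s + (fun=> 0) s).
  by apply/funext => s; rewrite addr0 (closL_parity _ epsP hg).
rewrite !conv_linl !conv0l !addr0 mulrDl mul1r [d * (e + 1)]mulrDr mulr1 !sgnD.
by have := sgn_sq K d; move: (sgn K d) => t tt; ring: tt.
Qed.

Lemma pull_slots_closL :
  (forall d (a : {scalar M}), dual_deg d a -> closL (d + 1) (fun w => a (Q w))) ->
  Q [::] = 0 ->
  forall d (f : series M), closL d f -> closL (d + 1) (pull slots f).
Proof.
move=> hQ Q0; apply: pull_approx => q l.
elim=> [{}q a qa|d1 d2 f1 f2 h1 IH1 h2 IH2].
  by have -> : pull slots (gen a) = (fun w => a (Q w));
    [apply/funext => w; exact: pull_slots_gen|exact: hQ].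
rewrite pull_slots_brk; [|exact: closL_lie..]; apply: approxD.
  by rewrite addrAC; apply: closL_brk => //; exact: closL_lie.
rewrite -[d1 + d2 + 1]add0r; apply: approxZ.
  rewrite -[sgn K d1]mulr1; apply: gf_gr_sgn; exact: gf_one.
by rewrite -addrA; apply: closL_brk => //; exact: closL_lie.
Qed.

End Derivation.

(** * The topology of pointwise convergence *)

Section Topology.
Variables (K : gradedField) (M : gradedModule K).

(** The index set of words gets the discrete topology only because the criterion
    for pointwise convergence is stated for topological index spaces. *)
Lemma ptws_cvg (F : set_system (series M)) (f : series M) : Filter F ->
  (F --> (f : top_series M)) <-> (forall s, F [set g : series M | g s = f s]).
Proof.
move=> FF.
have [h1 h2] :=
  @pointwise_cvgP (discrete_topology (seq M)) (discrete_topology K) F f FF.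
split=> [/h1 h s|h].
  by have /discrete_cvg := h s. 
by apply: h2 => s; apply/discrete_cvg; exact: (h s).
Qed.

(** Cylinders define a filter that converges to f, hence is finer than the
    neighbourhoods of f. *)
Lemma ptws_nbhs (f : series M) (A : set (series M)) :
  nbhs (f : top_series M) A -> exists S : seq (seq M),
    forall g : series M, {in S, g =1 f} -> A g.
Proof.
pose F : set_system (series M) := [set B | exists S : seq (seq M),
  forall g : series M, {in S, g =1 f} -> B g].
have FF : Filter F.
  split=> [|B C [S hS] [T hT]|B C BC [S hS]].
  - by exists [::].
  - exists (S ++ T) => g gf; split; [apply: hS|apply: hT] => s sS;
      by apply: gf; rewrite mem_cat sS ?orbT.
  - by exists S => g /hS /BC.
suff /(_ A) h : F --> (f : top_series M) by [].
by apply/ptws_cvg => s; exists [:: s] => g; apply; rewrite inE.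
Qed.

Lemma nbhs_eval (f : series M) s :
  nbhs (f : top_series M) [set g : series M | g s = f s].
Proof.
have FF : Filter (nbhs (f : top_series M)) by exact: nbhs_filter.
have [h _] := @ptws_cvg (nbhs (f : top_series M)) f FF.
by apply: h.
Qed.

Lemma nbhs_eval_in (f : series M) (S : seq (seq M)) :
  nbhs (f : top_series M) [set g : series M | {in S, g =1 f}].
Proof.
have FF : Filter (nbhs (f : top_series M)) by exact: nbhs_filter.
elim: S => [|s S IH]; first by apply: (@filterS _ _ FF) (@filterT _ _ FF) => g _ t.
apply: (@filterS2 _ _ FF) IH (nbhs_eval f s) => g gS gs t.
by rewrite inE => /orP[/eqP->|/gS].
Qed.

End Topology.

Section Continuity.
Variables (K : gradedField) (M N : gradedModule K).

Lemma pull_contL (A : seq N -> seq (seq M)) : contL (pull A : series M -> series N).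
Proof.
move=> d; apply: continuous_subspaceT => f.
have FF : Filter (nbhs (f : top_series M)) by exact: nbhs_filter.
have [_ h] := ptws_cvg (pull A f) (fmap_filter (pull A) FF); apply: h => w.
apply: (@filterS _ _ FF) (nbhs_eval_in f (A w)) => g gf.
exact: pull_local.
Qed.

Lemma contL_local (D : series M -> series N) d f : contL D -> hatL d f ->
  forall s, exists S : seq (seq M),
    forall g, hatL d g -> {in S, g =1 f} -> D g s = D f s.
Proof.
move=> /(_ d) cD hf s.
have /ptws_cvg /(_ s) := cD f.
rewrite /= /nbhs /=; rewrite -nbhs_subspace_in // => /ptws_nbhs[S hS].
by exists S => g hg /hS; apply.
Qed.

End Continuity.

(** * Continuous operators on the completed free Lie algebra *)

Section Operators.
Variables (K : gradedField) (M N : gradedModule K).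
Implicit Types (X Y : series M -> series N).

Definition local_on_hatL X : Prop := forall d f, hatL d f ->
  forall s, exists S : seq (seq M),
    forall g, hatL d g -> {in S, g =1 f} -> X g s = X f s.

(** The form in which continuity is used: in an argument on finitely many words, a
    series may be replaced by a finite combination of Lie monomials. *)
Definition operator p X : Prop := linearL p X /\ local_on_hatL X.

(** Homogeneity in the scalar 0, applied to a generator. *)
Lemma operator0 p X : operator p X -> X (fun=> 0) = fun=> 0.
Proof.
case=> -[_ _ hZ] _.
have h0 : hatL 0 (gen (\0 : {scalar M})).
  split.
    by apply: hatT_gen => i v _; exact: (gr0 (gf_grading K)).
  exists unit, (fun=> 0), (fun=> gen (\0 : {scalar M})), (fun=> 0), (fun=> 0).
  split=> [_|s].
    split; [exact: (gr0 (gf_grading K))| |exact: addr0].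
    by apply: lie_gen => i v _; exact: (gr0 (gf_grading K)).
  rewrite (_ : [set i : unit | _] = set0); last first.
    by apply/seteqP; split=> // i /=; rewrite mul0r eqxx.
  split=> //; rewrite fsbig1 => [|i _]; last by rewrite mul0r.
  by case: s => [|v [|? ?]].
have := hZ 0 0 0 _ (gr0 (gf_grading K) 0) h0.
have -> : 0 \*o gen (\0 : {scalar M}) = fun=> 0 by apply/funext => s /=; rewrite mul0r.
by move=> ->; apply/funext => s /=; rewrite mul0r.
Qed.

Lemma contL_operator p X : linearL p X -> contL X -> operator p X.
Proof. by move=> lX cX; split=> // d f hf s; exact: contL_local. Qed.

Variables (cM : coords M) (cN : coords N).

Lemma lie_hatL d (l : series M) : lie_monomial d l -> hatL d l.
Proof. by move=> hl; apply: (closL_hatL cM); exact: closL_lie. Qed.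

Lemma comb_hatL d (f : series M) : comb (@lie_monomial K M) d f -> hatL d f.
Proof. by move=> hf; apply: (closL_hatL cM); exact: comb_approx. Qed.

Lemma operatorB p X Y : operator p X -> operator p Y ->
  operator p (fun f s => X f s - Y f s).
Proof.
case=> -[dX aX zX] lX [[dY aY zY] lY]; split; first split.
- move=> d f hf; apply: (closL_hatL cN); apply: closLB; apply: hatL_closL.
    exact: dX.
  exact: dY.
- move=> d f g hf hg; rewrite (aX d) // (aY d) //.
  by apply/funext => s /=; rewrite opprD addrACA.
- move=> i d a f ai hf; rewrite (zX i d) // (zY i d) //.
  by apply/funext => s /=; rewrite mulrBr.
- move=> d f hf s; have [S hS] := lX d f hf s; have [T hT] := lY d f hf s.
  exists (S ++ T) => g hg gf; rewrite (hS g) ?(hT g) // => t tS;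
    by apply: gf; rewrite mem_cat tS ?orbT.
Qed.

Lemma pull_operator p (A : seq N -> seq (seq M)) :
  (forall d f, closL d f -> closL (d + p) (pull A f)) ->
  operator p (pull A : series M -> series N).
Proof.
move=> hA; apply: contL_operator; last exact: pull_contL.
split=> [d f /hatL_closL hf|d f g _ _|i d a f _ _].
- by apply: (closL_hatL cN); exact: hA.
- by apply/funext => w /=; rewrite /pull -big_split.
- by apply/funext => w /=; rewrite /pull mulr_sumr.
Qed.

(** The inductive step on the length of words.  In the Leibniz rule for a bracket,
    each cut of a word of length n either leaves X a shorter word, on which it
    vanishes, or leaves psi the empty word.  So X kills brackets in length n, and a
    series without linear part is a limit of combinations of brackets. *)
Lemma leibniz_vanish p X (psi : series M -> series N) n :
  operator p X ->
  (forall d e f g, hatL d f -> hatL e g -> exists d' e' c,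
     X (brk d e f g) =
     fun s => brk d' e (X f) (psi g) s + c * brk d e' (psi f) (X g) s) ->
  (forall d f, hatL d f -> psi f [::] = 0) ->
  (forall d f, hatL d f -> forall w, (size w < n)%N -> X f w = 0) ->
  forall d f, hatL d f -> (forall v, f [:: v] = 0) ->
  forall w, size w = n -> X f w = 0.
Proof.
move=> hX leib psi0 IH d f hf f1 w wn; subst n; have [[dX aX zX] lX] := hX.
have conv_l (g h : series N) : (forall v, (size v < size w)%N -> g v = 0) ->
    h [::] = 0 -> conv g h w = 0.
  move=> g0 h0; rewrite /conv big1 // => k _.
  have [kn|nk] := ltnP k (size w).
    by rewrite g0 ?mul0r //; move: (size_take_min k w); lia.
  by rewrite drop_oversize // h0 mulr0.
have conv_r (g h : series N) : (forall v, (size v < size w)%N -> g v = 0) ->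
    h [::] = 0 -> conv h g w = 0.
  move=> g0 h0; rewrite /conv big1 // => -[[|k] kw] _ /=; first by rewrite take0 h0 mul0r.
  by rewrite g0 ?mulr0 // size_drop; lia.
have [S hS] := lX d f hf w.
have [g cg eg] := closL_brackets (hatL_closL hf) f1 S.
have brk_lie q (l : series M) : is_brk q l -> lie_monomial q l.
  by case=> d1 [d2 [f1' [f2 [h1 h2 -> ->]]]]; exact: lie_brk.
have comb_brk_hatL q h : comb (@is_brk K M) q h -> hatL q h.
  move=> ch; apply: comb_hatL; apply: comb_bind ch => q' l /brk_lie.
  exact: comb1.
rewrite -(hS g) => [||s sS]; [|exact: comb_brk_hatL|by rewrite eg].
elim: cg {eg} => [|r q c l {hf f1 hS}f cr bl rq cf IHf].
  by rewrite (operator0 hX).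
have hl := lie_hatL (brk_lie _ _ bl).
have -> : (fun s => c * l s + f s) = (c \*o l) \+ f by apply/funext.
rewrite (aX d) /=; last first.
- exact: comb_brk_hatL.
- rewrite -rq; apply: comb_hatL; apply: combZ => //; apply: comb1; exact: brk_lie.
rewrite IHf addr0 (zX r q) //= .
case: bl {hl} => d1 [d2 [f1 [f2 [/lie_hatL h1 /lie_hatL h2 _ ->]]]].
have [d' [e' [b ->]]] := leib _ _ _ _ h1 h2.
have [X1 X2] := (IH _ _ h1, IH _ _ h2); have [p1 p2] := (psi0 _ _ h1, psi0 _ _ h2).
rewrite /brk (conv_l _ _ X1) // (conv_r _ _ X1) // (conv_l _ _ X2) //.
by rewrite (conv_r _ _ X2) // !mulr0 subrr mulr0 addr0 mulr0.
Qed.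

(** A continuous operator is the transpose of a map G of words on generators, as
    a |-> X(a)(y) is evaluation at a vector if it depends on finitely many
    coordinates of a.  Continuity gives this only for a in one degree at a time.
    But a nonzero value X(a)(y) is invertible, and dividing a by it moves a to the
    degree in which that value is 1. *)
Lemma operator_transpose p X : operator p X ->
  exists G : seq N -> M, forall d (a : {scalar M}), dual_deg d a ->
    forall y, X (gen a) y = a (G y).
Proof.
move=> hX; have [[dX aX zX] lX] := hX.
have hgen d (a : {scalar M}) : dual_deg d a -> hatL d (gen a).
  by move=> da; apply: lie_hatL; exact: lie_gen.
suff hb (b : seq (cB cN)) : exists g : M, forall d (a : {scalar M}), dual_deg d a ->
    X (gen a) (map (@ce _ _ cN) b) = a g.
  have /choice[g gP] := hb.
  suff /choice[G GP] : forall y, exists g : M, forall d (a : {scalar M}),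
      dual_deg d a -> X (gen a) y = a g by exists G => d a da y; exact: GP da.
  move=> y; have [L LP] := mlin_expand cN y.
  exists (\sum_(x <- L) x.1 *: g x.2) => d a da.
  have [[mf _] _] := dX _ _ (hgen _ _ da).
  rewrite (LP _ mf) linear_sum; apply: eq_bigr => x _ /=.
  by rewrite linearZ /= (gP _ _ _ da).
have [j yj] : exists j, word_deg (map (@ce _ _ cN) b) j.
  elim: b => [|x b [j bj]]; first by exists 0.
  exists (@cdeg _ _ cN x + j); exists (@cdeg _ _ cN x); first exact: ce_deg.
  by rewrite addrAC subrr add0r.
move: (map _ b) yj => y yj {b}.
have h0 : @hatL K M (- (p + j)) (fun=> 0) by apply: comb_hatL; exact: comb0.
have [S hS] := lX _ _ h0 y; rewrite (operator0 hX) in hS.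
(* The coordinates of the letters that occur in S. *)
have [A AP] : exists A : seq (cB cM), forall (a : {scalar M}),
    (forall b, b \in A -> a (ce b) = 0) -> {in S, gen a =1 fun=> 0}.
  elim: S {hS} => [|s S [A AP]]; first by exists [::].
  have [B BP] : exists B : seq (cB cM), forall (a : {scalar M}),
      (forall b, b \in B -> a (ce b) = 0) -> gen a s = 0.
    case: s => [|v [|? ?]]; [by exists [::]| |by exists [::]].
    have [B [_ _ vB]] := cco_seq cM v; exists B => a aB /=.
    rewrite vB linear_sum big_seq big1 // => b bB.
    by rewrite linearZ /= aB // mulr0.
  exists (A ++ B) => a aAB s'; rewrite inE => /orP[/eqP->|].
    by apply: BP => b bB; apply: aAB; rewrite mem_cat bB orbT.
  by apply: AP => b bA; apply: aAB; rewrite mem_cat bA.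
exists (\sum_(b <- undup A) X (gen (cco b)) y *: ce b) => d a da.
have /scalar_of[a' a'E] : forall c u v,
    a (c *: u + v) - \sum_(b <- undup A) a (ce b) * cco b (c *: u + v) =
    c * (a u - \sum_(b <- undup A) a (ce b) * cco b u) +
    (a v - \sum_(b <- undup A) a (ce b) * cco b v).
  move=> c u v; rewrite linearP mulrBr addrACA -opprD; congr (_ - _).
  rewrite mulr_sumr -big_split; apply: eq_bigr => b _ /=.
  by rewrite linearP /=; ring.
have da' : dual_deg d a'.
  move=> i v vi; rewrite a'E; apply: (grB (gf_grading K)); first exact: da.
  apply: (gr_sum (gf_grading K)) => b _.
  have := gf_mul (da _ _ (ce_deg b)) (cco_deg b vi).
  by have -> : d + cdeg b + (- cdeg b + i) = d + i by lia.
have a'0 b : b \in A -> a' (ce b) = 0.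
  move=> bA; rewrite a'E (bigD1_seq b) ?undup_uniq ?mem_undup //= cco_ce eqxx mulr1.
  rewrite big1 ?addr0 ?subrr // => b' b'b; by rewrite cco_ce (negbTE b'b) mulr0.
(* The form a' vanishes on the letters of S; dividing it by X(a')(y), if this is
   nonzero, gives a'' with X(a'')(y) = 1, against the choice of S. *)
have Xa' : X (gen a') y = 0.
  have [_ /(_ _ _ yj) Xd] := (dX _ _ (hgen _ _ da')).1.
  apply/eqP; apply: contraT => X0; have [c cd c1] := gf_inv_homog Xd X0.
  have /scalar_of[a'' a''E] : forall e u v, c * a' (e *: u + v) =
      e * (c * a' u) + c * a' v by move=> e u v; rewrite linearP /=; ring.
  have da'' : dual_deg (- (p + j)) a''.
    move=> i v vi; rewrite a''E; have := gf_mul cd (da' _ _ vi).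
    by have -> : - (d + p + j) + (d + i) = - (p + j) + i by lia.
  have e : gen a'' = c \*o gen a'.
    by apply/funext => -[|v [|? ?]] /=; rewrite ?mulr0.
  have inS : {in S, gen a'' =1 fun=> 0}.
    by apply: AP => b bA; rewrite a''E a'0 ?mulr0.
  have := hS _ (hgen _ _ da'') inS.
  rewrite e (zX _ _ _ _ cd (hgen _ _ da')) /= mulrC c1 => /eqP.
  by rewrite oner_eq0.
rewrite linear_sum /=; under eq_bigr do rewrite linearZ /=.
have : exists2 t : {scalar M}, dual_deg d t &
    (forall v, t v = \sum_(b <- undup A) a (ce b) * cco b v) /\
    X (gen t) y = \sum_(b <- undup A) a (ce b) * X (gen (cco b)) y.
  elim: (undup A) => [|b L [t dt [tE Xt]]].
    exists (\0 : {scalar M}); first by move=> i v _; exact: (gr0 (gf_grading K)).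
    split=> [v|]; first by rewrite big_nil.
    rewrite big_nil (_ : gen _ = fun=> 0) ?(operator0 hX) //.
    by apply/funext => -[|v [|? ?]].
  have /scalar_of[t' t'E] : forall c u v,
      a (ce b) * cco b (c *: u + v) + t (c *: u + v) =
      c * (a (ce b) * cco b u + t u) + (a (ce b) * cco b v + t v).
    by move=> c u v; rewrite !linearP /=; ring.
  have dc : hatL d (a (ce b) \*o gen (cco b)).
    apply: comb_hatL; rewrite -[d](addrK (cdeg b)).
    by apply: combZ; [exact: da (ce_deg b)|apply: comb1; apply: lie_gen; exact: cco_deg].
  exists t'; last split.
  - move=> i v vi; rewrite t'E; apply: (grD (gf_grading K)); last exact: dt.
    have := gf_mul (da _ _ (ce_deg b)) (cco_deg b vi).
    by have -> : d + cdeg b + (- cdeg b + i) = d + i by lia.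
  - by move=> v; rewrite t'E tE big_cons.
  have -> : gen t' = (a (ce b) \*o gen (cco b)) \+ gen t.
    by apply/funext => -[|v [|? ?]] /=; rewrite ?mulr0 ?addr0.
  rewrite (aX d) //=; last exact: hgen.
  rewrite (zX _ _ _ _ (da _ _ (ce_deg b)) (hgen _ _ (@cco_deg _ _ cM b))) /=.
  by rewrite Xt big_cons.
case=> t dt [tE Xt]; under eq_bigr do rewrite mulrC; rewrite -Xt.
have -> : gen a = gen a' \+ gen t.
  apply/funext => -[|v [|? ?]] /=; rewrite ?addr0 // a'E tE subrK //.
by rewrite (aX d) /= ?Xa' ?add0r //; exact: hgen.
Qed.

End Operators.

Lemma operator_comp (K : gradedField) (M N P : gradedModule K) p q
    (X : series M -> series N) (Y : series N -> series P) :
  operator p X -> operator q Y -> operator (p + q) (fun f => Y (X f)).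
Proof.
case=> -[dX aX zX] lX [[dY aY zY] lY]; split; first split.
- by move=> d f hf; rewrite addrA; apply: dY; exact: dX.
- by move=> d f g hf hg; rewrite (aX d) // (aY (d + p)) //; exact: dX.
- by move=> i d a f ai hf; rewrite (zX i d) // (zY i (d + p)) //; exact: dX.
- move=> d f hf s; have [T hT] := lY _ _ (dX _ _ hf) s.
  have [S hS] : exists S : seq (seq M),
      forall g, hatL d g -> {in S, g =1 f} -> {in T, X g =1 X f}.
    elim: T {hT} => [|t T [S hS]]; first by exists [::].
    have [S' hS'] := lX _ _ hf t; exists (S' ++ S) => g hg gf u.
    rewrite inE => /orP[/eqP->|uT].
      by apply: hS' => // v vS; apply: gf; rewrite mem_cat vS.
    by apply: hS => // v vS; apply: gf; rewrite mem_cat vS orbT.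
  by exists S => g hg gf; apply: hT; [exact: dX|exact: hS].
Qed.

(** * Contraction of a complex over a graded field *)

Lemma hcomp_morph (M N : zmodType) (g : int -> set M) (g' : int -> set N)
    (f : M -> N) t : is_grading g -> is_grading g' ->
  (forall x y, f (x + y) = f x + f y) ->
  (forall i x, g i x -> g' (i + t) (f x)) ->
  forall i x, hcomp g' (i + t) (f x) = f (hcomp g i x).
Proof.
move=> gP gP' fD fg i x; have f0 : f 0 = 0.
  by apply: (addrI (f 0)); rewrite -fD !addr0.
have [A [uA A0 xE]] := hcomp_seq gP x.
have gA j : g' (j + t) (f (hcomp g j x)) by apply: fg; exact: gr_hcomp.
have gN j : j != i -> hcomp g' (i + t) (f (hcomp g j x)) = 0.
  move=> ji; apply: (hcomp_neq gP' (gA j)); apply: contra ji => /eqP h.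
  by apply/eqP; lia.
rewrite {1}xE (big_morph f fD f0) hcomp_sum //.
case: (boolP (i \in A)) => iA.
  rewrite (bigD1_seq i) //= big1 ?addr0; last by move=> j /gN.
  exact: hcomp_id.
rewrite A0 // f0 big_seq big1 // => j jA; apply: gN.
by apply: contra iA => /eqP <-.
Qed.

Lemma linear_of (R : nzRingType) (M N : lmodType R) (f : M -> N) :
  (forall a x y, f (a *: x + y) = a *: f x + f y) ->
  exists g : {linear M -> N}, g =1 f.
Proof.
move=> hf; pose h : GRing.isLinear R M N *:%R f := GRing.isLinear.Build _ _ _ _ f hf.
by exists (HB.pack f h : {linear M -> N}).
Qed.

Section Complements.
Variables (K : gradedField) (V : gradedModule K) (cV : coords V).
Local Notation gr := (@gm_gr _ V).
Local Notation co := (@cco _ _ cV).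
Local Notation e := (@ce _ _ cV).
Local Notation deg := (@cdeg _ _ cV).

Definition graded_submodule (A : set V) : Prop :=
  [/\ A 0, forall a x y, A x -> A y -> A (a *: x + y)
    & forall i x, A x -> A (hcomp gr i x)].

Definition spanB (S : set (cB cV)) : set V :=
  [set v | forall b, ~ S b -> co b v = 0].

Lemma co_hcomp i b v : co b (hcomp gr i v) = hcomp (@gf_gr K) (i - deg b) (co b v).
Proof.
rewrite (@hcomp_morph _ _ gr (@gf_gr K) (co b) (- deg b)) //.
- exact: gm_grading.
- exact: gf_grading.
- by move=> x y; rewrite linearD.
- by move=> j x xj; rewrite addrC; exact: cco_deg.
Qed.

Lemma spanB_submodule S : graded_submodule (spanB S).
Proof.
split=> [b _|a x y Sx Sy b Sb|i x Sx b Sb]; first by rewrite linear0.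
  by rewrite linearP Sx // Sy // mulr0 addr0.
by rewrite co_hcomp Sx // hcomp_zero //; exact: gf_grading.
Qed.

Lemma submoduleB A x y : graded_submodule A -> A x -> A y -> A (x - y).
Proof. by case=> _ h _ Ax Ay; rewrite addrC -scaleN1r; exact: h. Qed.

Lemma submoduleZ A a x : graded_submodule A -> A x -> A (a *: x).
Proof. by case=> h0 h _ Ax; rewrite -[_ *: _]addr0; exact: h. Qed.

Lemma submoduleD A x y : graded_submodule A -> A x -> A y -> A (x + y).
Proof. by case=> _ h _ Ax Ay; rewrite -[x]scale1r; exact: h. Qed.

(** Exchange: a maximal set S of basis vectors whose span avoids A spans a
    complement.  If e_b with b outside S were not in A + span S, a nonzero
    element of A in the span of S and b would have a nonzero homogeneous, hence
    invertible, coefficient at b after passing to a homogeneous component. *)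
Lemma complement_exists A : graded_submodule A -> exists S : set (cB cV),
  (forall v, A v -> spanB S v -> v = 0) /\
  (forall v, exists2 w, spanB S w & A (v - w)).
Proof.
move=> hA; have [A0 AP Ah] := hA.
pose P (S : set (cB cV)) := forall v, A v -> spanB S v -> v = 0.
have [F FP Ftot|S [PS Smax]] := @Zorn_bigcup _ P.
  move=> v Av Fv.
  have [L [_ L0 vE]] := cco_seq cV v.
  have [->//|v0] := eqVneq v 0.
  have [X FX XL] : exists2 X, F X & forall b, b \in L -> co b v != 0 -> X b.
    have hb b : co b v != 0 -> exists2 X, F X & X b.
      move=> cb; apply: contrapT => h; move/eqP: cb; apply; apply: Fv => -[X FX Xb].
      by apply: h; exists X.
    have [X0 FX0] : exists X, F X.
      apply: contrapT => h; move/eqP: v0; apply; rewrite vE big1 // => b _.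
      have [->|/hb[X FX _]] := eqVneq (co b v) 0; first by rewrite scale0r.
      by case: h; exists X.
    elim: (L) => [|b L' [X FX XL]]; first by exists X0.
    have [cb|/hb[Y FY Yb]] := eqVneq (co b v) 0.
      exists X => // b'; rewrite inE => /orP[/eqP->|]; last exact: XL.
      by rewrite cb eqxx.
    have [XY|YX] := Ftot X Y FX FY.
      exists Y => // b'; rewrite inE => /orP[/eqP->//|b'L cb'].
      by apply: XY; exact: XL.
    exists X => // b'; rewrite inE => /orP[/eqP->//|]; last exact: XL.
    by move=> _; exact: YX.
  apply: (FP X FX v Av) => b Xb; apply/eqP; apply: contraT => cb.
  have [bL|bL] := boolP (b \in L); last by rewrite L0 ?eqxx in cb.
  by case: Xb; exact: XL.
exists S; split=> // v.
have eb b : exists2 w, spanB S w & A (e b - w).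
  have [Sb|Sb] := pselect (S b).
    exists (e b); last by rewrite subrr.
    by move=> b' Sb'; rewrite cco_ce; case: eqP => // bb'; rewrite bb' in Sb'.
  have : ~ P (S `|` [set b]).
    apply: Smax; split; first by move=> x Sx; left.
    by move=> h; apply: Sb; apply: h; right.
  move/existsNP => [x /not_implyP[Ax /not_implyP[Sx x0]]].
  have cb : co b x != 0.
    apply: contra_notN x0 => /eqP cb; apply: PS => // b' Sb'.
    have [->//|bb'] := eqVneq b' b.
    by apply: Sx => -[//|/= h]; rewrite h eqxx in bb'.
  (* The coefficient of b in x need not be homogeneous, so it is not yet invertible. *)
  have [i ci] : exists i, hcomp (@gf_gr K) i (co b x) != 0.
    apply: contrapT => h; move/eqP: cb; apply; apply: (hcomp_eq0 (gf_grading K)) => i.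
    by apply/eqP; apply: contraT => ci; case: h; exists i.
  pose y := hcomp gr (i + deg b) x.
  have cy : co b y = hcomp (@gf_gr K) i (co b x) by rewrite co_hcomp addrK.
  have [c _ cc] := gf_inv_homog (gr_hcomp (gf_grading K) i (co b x)) ci.
  exists (e b - c *: y) => [b' Sb'|]; last first.
    by rewrite opprB addrC subrK; apply: (submoduleZ _ hA); exact: Ah.
  rewrite linearB linearZ /= cco_ce.
  have [->|bb'] := eqVneq b' b; first by rewrite cy mulrC cc subrr.
  rewrite co_hcomp Sx ?hcomp_zero ?mulr0 ?subr0 //; first exact: gf_grading.
  by move=> -[//|/= h]; rewrite h eqxx in bb'.
have /choice[w wP] : forall b, exists w, spanB S w /\ A (e b - w).
  by move=> b; have [w] := eb b; exists w.
have [L [_ _ vE]] := cco_seq cV v.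
exists (\sum_(b <- L) co b v *: w b).
  apply: (@big_ind _ (spanB S)) => [|x y|b _]; first by case: (spanB_submodule S).
    exact: (submoduleD (spanB_submodule S)).
  by apply: (submoduleZ _ (spanB_submodule S)); case: (wP b).
rewrite {1}vE -sumrB; apply: (@big_ind _ A) => [//|x y|b _].
  exact: (submoduleD hA).
by rewrite -scalerBr; apply: (submoduleZ _ hA); case: (wP b).
Qed.

Lemma projection_exists A : graded_submodule A ->
  exists (S : set (cB cV)) (f : {linear V -> V}),
    [/\ forall v, spanB S (f v), forall v, A (v - f v),
        forall v, A v -> f v = 0, forall v, spanB S v -> f v = v
      & forall i v, gr i v -> gr i (f v)].
Proof.
move=> hA; have [S [inj dec]] := complement_exists hA; have hS := spanB_submodule S.
have /choice[f fP] : forall v, exists w, spanB S w /\ A (v - w).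
  by move=> v; have [w] := dec v; exists w.
have f_uniq v w : spanB S w -> A (v - w) -> f v = w.
  move=> Sw Aw; have [Sf Af] := fP v; apply/eqP; rewrite -subr_eq0; apply/eqP.
  apply: inj; last exact: (submoduleB hS).
  by rewrite -(subrKA v) -[f v - v]opprB addrC; exact: (submoduleB hA).
have /linear_of[g gE] : forall a x y, f (a *: x + y) = a *: f x + f y.
  move=> a x y; have [Sx Ax] := fP x; have [Sy Ay] := fP y.
  apply: f_uniq; first by case: hS => _ h _; exact: h.
  rewrite opprD addrACA -scalerBr; by case: hA => _ h _; exact: h.
exists S, g; split=> [v|v|v Av|v Sv|i v vi]; rewrite gE.
- by case: (fP v).
- by case: (fP v).
- by apply: f_uniq; [case: hS|rewrite subr0].
- by apply: f_uniq; rewrite // subrr; case: hA.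
- have VP := gm_grading V; have [Sf Af] := fP v.
  have -> : f v = hcomp gr i (f v); last exact: gr_hcomp.
  apply: f_uniq; first by case: hS => _ _; apply.
  by rewrite -{1}(hcomp_id VP vi) -hcompB //; case: hA => _ _; apply.
Qed.

Variable d : {linear V -> V}.
Hypothesis d_deg : forall i v, gr i v -> gr (i + 1) (d v).
Hypothesis dd : forall v, d (d v) = 0.

(** Hodge decomposition without inner products: with B' a complement of the
    cycles and H' a complement of the sum of B' and the boundaries, the
    projection i of H' to the cycles along B' identifies H' with the cohomology,
    and h inverts d from the boundaries to B', up to sign. *)
Lemma contraction_exists :
  exists (S : set (cB cV)) (p i h : {linear V -> V}),
    [/\ forall v, spanB S (p v),
        forall v, spanB S v -> p (i v) = v /\ d (i v) = 0,
        forall v, p (d v) = 0,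
        forall v, d (h v) + h (d v) = i (p v) - v
      & forall n v, gr n v -> [/\ gr n (p v), gr n (i v) & gr (n - 1) (h v)]].
Proof.
have VP := gm_grading V.
have hcomp_d n x : hcomp gr (n + 1) (d x) = d (hcomp gr n x).
  by apply: hcomp_morph => // x' y; rewrite linearD.
have [S1 [f [fS fZ fZ0 fid f_deg]]] : exists (S : set (cB cV)) (f : {linear V -> V}),
    [/\ forall v, spanB S (f v), forall v, d (v - f v) = 0,
        forall v, d v = 0 -> f v = 0, forall v, spanB S v -> f v = v
      & forall i v, gr i v -> gr i (f v)].
  apply: (projection_exists (A := [set v | d v = 0])).
  split=> [|a x y /= dx dy|n x /= dx]; first exact: linear0.
    by rewrite linearP dx dy scaler0 addr0.
  by rewrite -hcomp_d dx hcomp_zero.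
have df v : d (f v) = d v by apply/eqP; rewrite eq_sym -subr_eq0 -linearB fZ.
pose B1 := [set v | exists x w, spanB S1 w /\ v = d x + w].
have B1P : graded_submodule B1.
  have [s0 sl sh] := spanB_submodule S1.
  split=> [|a x y [x1 [w1 [h1 ->]]] [x2 [w2 [h2 ->]]]|n x [x1 [w1 [h1 ->]]]].
  - by exists 0, 0; split; rewrite // linear0 addr0.
  - exists (a *: x1 + x2), (a *: w1 + w2); split; first exact: sl.
    by rewrite linearP scalerDr addrACA.
  - exists (hcomp gr (n - 1) x1), (hcomp gr n w1); split; first exact: sh.
    by rewrite hcompD // -hcomp_d subrK.
have [S2 [p [pS pB pB0 pid p_deg]]] := projection_exists B1P.
(* h v is characterised by v - p v + d (h v) being in the span of S1. *)
have /choice[h hP] : forall v, exists x,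
    spanB S1 x /\ spanB S1 (v - p v + d x).
  move=> v; have [x [w [Sw E]]] := pB v.
  exists (- f x); split.
    by rewrite -scaleN1r; apply: (submoduleZ _ (spanB_submodule S1)); exact: fS.
  by rewrite E linearN df addrAC subrr add0r.
have h_uniq v x : spanB S1 x -> spanB S1 (v - p v + d x) -> h v = x.
  move=> Sx Svx; have [Sh Svh] := hP v.
  have hS := spanB_submodule S1.
  have e1 : d (h v - x) = f (d (h v - x)).
    rewrite fid // linearB.
    have -> : d (h v) - d x = (v - p v + d (h v)) - (v - p v + d x).
      by rewrite opprD addrACA subrr add0r.
    exact: (submoduleB hS).
  rewrite fZ0 // in e1; apply/eqP; rewrite -subr_eq0 -(fid (h v - x)).
    by rewrite fZ0.
  exact: (submoduleB hS).
have /linear_of[h' h'E] : forall a x y, h (a *: x + y) = a *: h x + h y.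
  move=> a x y; have [Sx Sdx] := hP x; have [Sy Sdy] := hP y.
  have [_ sl _] := spanB_submodule S1.
  apply: h_uniq; first exact: sl.
  have -> : a *: x + y - p (a *: x + y) + d (a *: h x + h y) =
      a *: (x - p x + d (h x)) + (y - p y + d (h y)).
    by apply: (cco_sep (cM := cV)) => b; rewrite !(linearD, linearN, linearZ) /=; ring.
  exact: sl.
have /linear_of[i iE] : forall a x y, (a *: x + y) - f (a *: x + y) =
    a *: (x - f x) + (y - f y).
  by move=> a x y; rewrite linearP opprD addrACA scalerBr.
exists S2, p, i, h'; split=> [//|v Sv|v|v|n v vn].
- rewrite !iE linearB pid // pB0 ?subr0 //.
  by exists 0, (f v); split; rewrite // linear0 add0r.
- by apply: pB0; exists v, 0; split; [case: (spanB_submodule S1)|rewrite addr0].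
- have hdv : h (d v) = - f v.
    have pd : p (d v) = 0.
      by apply: pB0; exists v, 0; split; [case: (spanB_submodule S1)|rewrite addr0].
    apply: h_uniq.
      by rewrite -scaleN1r; apply: (submoduleZ _ (spanB_submodule S1)); exact: fS.
    by rewrite pd subr0 linearN df subrr; case: (spanB_submodule S1).
  have [Sh Svh] := hP v.
  have := fid _ Svh; rewrite linearD (fZ0 (d (h v))) ?dd // addr0 linearB.
  rewrite !h'E hdv iE => E.
  have -> : d (h v) = f v - f (p v) - (v - p v) by rewrite E addrC addKr.
  apply: (cco_sep (cM := cV)) => b; rewrite !(linearD, linearN) /=; ring.
- split; first exact: p_deg.
    by rewrite iE; apply: grB => //; exact: f_deg.
  rewrite h'E; have [Sh Svh] := hP v; have [_ _ sh] := spanB_submodule S1.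
  have -> : h v = hcomp gr (n - 1) (h v); last exact: gr_hcomp.
  apply: h_uniq; first exact: sh.
  have := sh n _ Svh; rewrite hcompD // hcompB // (hcomp_id VP vn).
  by rewrite (hcomp_id VP (p_deg _ _ vn)) -{1}[n](subrK 1) hcomp_d.
Qed.

End Complements.

(** * Spans of basis vectors as graded modules *)

Section Spans.
Variables (K : gradedField) (V : gradedModule K) (cV : coords V).
Variable S : set (cB cV).
Local Notation gr := (@gm_gr _ V).

(** A boolean predicate, as the construction of subtypes requires. *)
Definition in_spanB : {pred V} := fun v => `[< spanB S v >].

Lemma in_spanB_closed : submod_closed in_spanB.
Proof.
have [s0 sl _] := spanB_submodule S; split; first exact/asboolP.
by move=> a x y /asboolP Sx /asboolP Sy; apply/asboolP; exact: sl.
Qed.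

HB.instance Definition _ := GRing.isSubmodClosed.Build K V in_spanB in_spanB_closed.

Record spanT := SpanT { span_val :> V; _ : span_val \in in_spanB }.
HB.instance Definition _ := [isSub for span_val].
HB.instance Definition _ := [Choice of spanT by <:].
HB.instance Definition _ := [SubChoice_isSubLmodule of spanT by <:].

Lemma span_valP (u : spanT) : spanB S (val u).
Proof. by apply/asboolP; exact: (valP u). Qed.

Lemma span_valB (x y : spanT) : val (x - y) = val x - val y.
Proof. exact: raddfB. Qed.
Lemma span_val0 : val (0 : spanT) = 0. Proof. exact: raddf0. Qed.
Lemma span_valZ a (x : spanT) : val (a *: x) = a *: val x.
Proof. exact: linearZ. Qed.

Lemma span_val_sum (T : Type) (s : seq T) (F : T -> spanT) :
  val (\sum_(t <- s) F t) = \sum_(t <- s) val (F t).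
Proof. exact: raddf_sum. Qed.

Definition span_of v (Sv : spanB S v) : spanT := SpanT (introT (asboolP _) Sv).

Definition span_gr (i : int) : set spanT := [set u | gr i (val u)].

Lemma span_valP_lin a (x y : spanT) : val (a *: x + y) = a *: val x + val y.
Proof. exact: linearP. Qed.

Lemma span_grading : is_grading span_gr.
Proof.
have VP := gm_grading V; have [_ _ sh] := spanB_submodule S.
split=> [i|i x y gx gy|x].
- by rewrite /span_gr /mkset span_val0; exact: gr0.
- by rewrite /span_gr /mkset span_valB; exact: grB.
have [A [uA A0 xE]] := hcomp_seq VP (val x).
pose c i := span_of (sh i _ (span_valP x)).
have c0 i : i \notin A -> c i = 0 by move=> /A0 iA; apply: val_inj; rewrite span_val0.
exists c; split; first split.
- by move=> i; exact: gr_hcomp.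
- by apply: (@uniq_seq_finite_set _ _ A) => i /=; apply: contraR => /c0 ->.
- by apply: val_inj; rewrite (finsum_seq uA c0) span_val_sum.
move=> c' [c'g fin xE']; apply/funext => i; apply: val_inj => /=.
have [B uB BP] := finite_set_uniq_seq fin.
have c'0 j : j \notin B -> c' j = 0.
  by move=> jB; apply/eqP; apply: contraNT jB => cj; apply/BP.
apply: (hcomp_uniq VP uB (c := fun i => val (c' i))) => [//|j /c'0 ->|].
  exact: span_val0.
by rewrite xE' (finsum_seq uB c'0) span_val_sum.
Qed.

Lemma span_scale i j (a : K) (u : spanT) :
  gf_gr i a -> span_gr j u -> span_gr (i + j) (a *: u).
Proof. by move=> ai uj; rewrite /span_gr /mkset span_valZ; exact: gm_scale. Qed.

Definition spanM : gradedModule K := GradedModule span_grading span_scale.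

Lemma to_span (f : {linear V -> V}) : (forall v, spanB S (f v)) ->
  exists g : {linear V -> spanM}, forall v, val (g v : spanT) = f v.
Proof.
move=> fS; have [|g gE] := @linear_of K V spanM (fun v => span_of (fS v)).
  by move=> a x y; apply: val_inj; rewrite span_valP_lin /= linearP.
by exists g => v; rewrite gE.
Qed.

Lemma of_span (f : {linear V -> V}) :
  exists g : {linear spanM -> V}, forall u, g u = f (val (u : spanT)).
Proof.
have [|g gE] := @linear_of K spanM V (fun u : spanT => f (val u)).
  by move=> a x y; rewrite span_valP_lin linearP.
by exists g.
Qed.

Lemma span_coords : inhabited (coords spanM).
Proof.
pose B : choiceType := {b : cB cV | `[< S b >]}.
have eS (b : B) : spanB S (ce (val b)).
  move=> b' Sb'; rewrite cco_ce; case: eqP => // bb'.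
  by case: Sb'; rewrite bb'; apply/asboolP; exact: (valP b).
have /choice[f fP] : forall b : B, exists f : {scalar spanM},
    forall u : spanT, f u = cco (val b) (val u).
  move=> b; have [|f fP] := @scalar_of K spanM (fun u : spanT => cco (val b) (val u)).
    by move=> a x y; rewrite !linearP.
  by exists f.
constructor; apply: (@Coords K spanM B (fun b => span_of (eS b))
  (fun b => cdeg (val b)) f).
- by move=> b; exact: ce_deg.
- by move=> b i u ui; rewrite fP; exact: cco_deg.
- by move=> b b'; rewrite fP /= cco_ce.
move=> u; have [L [uL L0 vE]] := cco_seq cV (val u).
exists (pmap insub L); split=> [|b bL|].
- exact: pmap_sub_uniq.
- rewrite fP; apply: L0; apply: contra bL => bL.
  by rewrite mem_pmap_sub.
- apply: val_inj; rewrite span_val_sum {1}vE.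
  transitivity (\sum_(b <- [seq val b | b <- pmap (insub : _ -> option B) L])
    cco b (val u) *: ce b).
    rewrite pmap_filter; last exact: insubK.
    rewrite big_filter [RHS]big_mkcond; apply: eq_bigr => b _.
    rewrite isSome_insub; case: asboolP => // Sb.
    by rewrite (span_valP u) // scale0r.
  by rewrite big_map; apply: eq_bigr => b _; rewrite span_valZ fP.
Qed.

End Spans.

Lemma susp_coords (K : gradedField) (V : gradedModule K) (cV : coords V) :
  coords (susp V).
Proof.
apply: (@Coords K (susp V) (cB cV) (@ce _ _ cV) (fun b => cdeg b - 1) (@cco _ _ cV)).
- by move=> b /=; rewrite subrK; exact: ce_deg.
- move=> b i v vi; have := cco_deg b vi.
  by have -> : - cdeg b + (i + 1) = - (cdeg b - 1) + i by lia.
- exact: (cco_ce (c := cV)).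
- exact: (cco_seq cV).
Defined.

(** The involution is defined through the functionals that have to see it, and its
    linearity follows from its uniqueness. *)
Lemma parity_exists (K : gradedField) (M : gradedModule K) (cM : coords M) :
  exists eps : {linear M -> M}, is_parity eps /\
    forall i v, gm_gr i v -> eps v = sgn K i *: v.
Proof.
have MP := gm_grading M.
have /choice[f fP] : forall v : M, exists w, forall d (a : {scalar M}),
    dual_deg d a -> a w = sgn K d * a v.
  move=> v; have [A [uA A0 vE]] := hcomp_seq MP v.
  exists (\sum_(i <- A) sgn K i *: hcomp (@gm_gr _ M) i v) => d a da.
  rewrite {2}vE !linear_sum mulr_sumr; apply: eq_bigr => i _.
  rewrite linearZ /=; have ai := da _ _ (gr_hcomp MP i v).
  have := sgn_scal i ai; rewrite -addrA sgnD => h.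
  have : sgn K (i + i) = 1 by rewrite sgnD sgn_sq.
  by move=> h'; rewrite h' mulr1 in h.
have f_uniq v w : (forall d (a : {scalar M}), dual_deg d a -> a w = sgn K d * a v) ->
    f v = w.
  by move=> wP; apply: (dual_sep cM) => d a da; rewrite (fP v d) // (wP d).
have /linear_of[g gE] : forall a x y, f (a *: x + y) = a *: f x + f y.
  move=> c x y; apply: f_uniq => d a da.
  by rewrite !linearP (fP x d) // (fP y d) //=; ring.
exists g; split=> [d a da v|i v vi]; rewrite gE; first exact: fP.
apply: f_uniq => d a da; rewrite linearZ /=.
have := sgn_scal (- i) (da _ _ vi); rewrite addrK => ->.
by congr (_ * _); apply: sgn_cat; rewrite abszN.
Qed.

(** * The maps of words that define a homological derivation *)

Section BrkSub.
Variables (K : gradedField) (M : gradedModule K).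
Implicit Types f g : series M.

Lemma convBl f f' g s : conv (fun s => f s - f' s) g s = conv f g s - conv f' g s.
Proof. by rewrite /conv -sumrB; apply: eq_bigr => k _; rewrite mulrBl. Qed.

Lemma convBr f g g' s : conv f (fun s => g s - g' s) s = conv f g s - conv f g' s.
Proof. by rewrite /conv -sumrB; apply: eq_bigr => k _; rewrite mulrBr. Qed.

Lemma brkBl d e f f' g s :
  brk d e (fun s => f s - f' s) g s = brk d e f g s - brk d e f' g s.
Proof. by rewrite /brk convBl convBr; ring. Qed.

Lemma brkBr d e f g g' s :
  brk d e f (fun s => g s - g' s) s = brk d e f g s - brk d e f g' s.
Proof. by rewrite /brk convBl convBr; ring. Qed.

Lemma linear_part d f : hatL d f ->
  exists2 a : {scalar M}, dual_deg d a & forall v, f [:: v] = a v.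
Proof.
case=> -[mf df] _; have /scalar_of[a aE] := mf [::] [::].
exists a => // i v vi; rewrite aE; apply: df; exists i => //.
by rewrite subrr.
Qed.

End BrkSub.

Lemma scalar_comp (K : nzRingType) (M N : lmodType K) (a : {scalar M})
  (f : {linear N -> M}) : exists b : {scalar N}, forall v, b v = a (f v).
Proof.
have /scalar_of[b bE] : forall c x y, a (f (c *: x + y)) = c * a (f x) + a (f y).
  by move=> c x y; rewrite !linearP.
by exists b.
Qed.

Section Transpose.
Variables (K : gradedField) (M : gradedModule K) (cM : coords M).
Variable m : series M -> series M.
Hypothesis mD : derivation1 m.
Hypothesis mm0 : forall d f, hatL d f -> forall s, m (m f) s = 0.

Lemma derivation_operator : operator 1 m.
Proof. by case: mD => lm cm _; exact: contL_operator. Qed.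

(** The case n = 1 of the induction on length: the linear part of m f depends only
    on the linear part of f. *)
Lemma derivation_letter d f : hatL d f -> (forall v, f [:: v] = 0) ->
  forall v, m f [:: v] = 0.
Proof.
move=> hf f1 v; have mO := derivation_operator.
apply: (leibniz_vanish cM (psi := id) (n := 1) mO _ _ _ hf f1) => //.
- case: mD => _ _ mb d1 d2 f1' f2 h1 h2.
  by exists (d1 + 1), (d2 + 1), (sgn K d1); rewrite (mb d1 d2).
- by move=> d1 f2 /hatL_closL/closL_nil.
- move=> d1 f2 h2 [|//] _; apply: (@closL_nil _ _ (d1 + 1)); apply: hatL_closL.
  by case: mO => -[h _ _] _; exact: h.
Qed.

(** The transpose of m on generators splits into a differential d on letters and a
    part G without linear component.  In length one, m(m a) = 0 says d d = 0; what
    remains of it says that m (a G) = - a d G, as m a = a d + a G. *)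
Lemma transpose_exists :
  exists (G : seq M -> M) (d : {linear M -> M}),
    [/\ forall k v, gm_gr k v -> gm_gr (k + 1) (d v),
        forall v, d (d v) = 0,
        G [::] = 0 /\ forall v, G [:: v] = 0,
        forall q (a : {scalar M}), dual_deg q a -> forall y,
          m (gen a) y = (if y is [:: v] then a (d v) else 0) + a (G y)
      & forall q (a b : {scalar M}), dual_deg q a -> (forall v, b v = a (d v)) ->
          hatL (q + 1) (fun y => a (G y)) /\
          forall y, m (fun y => a (G y)) y = - b (G y)].
Proof.
have mO := derivation_operator; have [[dm am zm] lm] := mO.
have [G GP] := operator_transpose cM cM mO.
have hgen q (a : {scalar M}) : dual_deg q a -> hatL q (gen a).
  by move=> qa; apply: (lie_hatL cM); exact: lie_gen.
have G0 : G [::] = 0.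
  apply: (dual_sep cM) => q a qa; rewrite -(GP _ _ qa) linear0.
  by apply: closL_nil; apply: hatL_closL; exact: dm (hgen _ _ qa).
have /linear_of[d dE] : forall c x y, G [:: c *: x + y] = c *: G [:: x] + G [:: y].
  move=> c x y; apply: (dual_sep cM) => q a qa; rewrite linearP -!(GP _ _ qa).
  by have [[mf _] _] := dm _ _ (hgen _ _ qa); exact: (mf [::] [::]).
have d_dual q (a b : {scalar M}) : dual_deg q a -> (forall v, b v = a (d v)) ->
    dual_deg (q + 1) b.
  move=> qa ba i v vi; rewrite ba dE -(GP _ _ qa).
  have [[_ df] _] := dm _ _ (hgen _ _ qa); apply: df; exists i => //=.
  by rewrite subrr.
have d_deg k v : gm_gr k v -> gm_gr (k + 1) (d v).
  move=> vk; have MP := gm_grading M.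
  have -> : d v = hcomp (@gm_gr _ M) (k + 1) (d v); last exact: gr_hcomp.
  apply: (cco_sep (cM := cM)) => b.
  have [a aE] := scalar_comp (cco b) d.
  have := d_dual _ _ _ (@cco_deg _ _ cM b) aE _ _ vk; rewrite aE => h.
  rewrite co_hcomp (hcomp_id (gf_grading K)) //.
  by have -> : k + 1 - cdeg b = - cdeg b + 1 + k by lia.
pose G' y := if y is [:: v] then 0 else G y.
have mE q (a : {scalar M}) : dual_deg q a -> forall y,
    m (gen a) y = (if y is [:: v] then a (d v) else 0) + a (G' y).
  move=> qa y; rewrite (GP _ _ qa); case: y => [|v [|? ?]] /=.
  - by rewrite add0r.
  - by rewrite dE linear0 addr0.
  - by rewrite add0r.
have m_split q (a b : {scalar M}) : dual_deg q a -> (forall v, b v = a (d v)) ->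
    (fun y => a (G' y)) = (fun y => m (gen a) y - gen b y).
  move=> qa ba; apply/funext => y; rewrite (mE _ _ qa); case: y => [|v [|? ?]] /=.
  - by rewrite add0r subr0.
  - by rewrite ba addrC addKr.
  - by rewrite add0r subr0.
have hT q (a b : {scalar M}) : dual_deg q a -> (forall v, b v = a (d v)) ->
    hatL (q + 1) (fun y => a (G' y)).
  move=> qa ba; rewrite (m_split _ _ _ qa ba); apply: (closL_hatL cM).
  apply: closLB; first by apply: hatL_closL; apply: dm; exact: hgen.
  by apply: hatL_closL; apply: hgen; exact: d_dual ba.
have mT q (a b : {scalar M}) : dual_deg q a -> (forall v, b v = a (d v)) ->
    forall y, m (gen b) y + m (fun y => a (G' y)) y = 0.
  move=> qa ba y; rewrite -(mm0 (hgen _ _ qa) y).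
  have -> : m (gen a) = gen b \+ (fun y => a (G' y)).
    by apply/funext => y'; rewrite (m_split _ _ _ qa ba) /= addrC subrK.
  rewrite (am (q + 1)) //; first by apply: hgen; exact: d_dual ba.
  exact: hT ba.
have dd v : d (d v) = 0.
  apply: (dual_sep cM) => q a qa; have [b ba] := scalar_comp a d.
  have := mT _ _ _ qa ba [:: v]; rewrite (derivation_letter (hT _ _ _ qa ba)).
    rewrite (mE _ _ (d_dual _ _ _ qa ba)) /= linear0 !addr0 ba => ->.
    by rewrite linear0.
  by move=> v'; rewrite /= linear0.
exists G', d; split=> // q a b qa ba; split; first exact: hT ba.
move=> y; have [c cb] := scalar_comp b d.
apply/eqP; rewrite -addr_eq0 addrC; apply/eqP; rewrite -[RHS](mT _ _ _ qa ba y).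
congr (_ + _); rewrite (mE _ _ (d_dual _ _ _ qa ba)).
by case: y => [|v [|? ?]] /=; rewrite ?add0r // !ba dd !linear0 addr0.
Qed.

End Transpose.

(** * Homotopy transfer *)

Section Transfer.
Variables (K : gradedField) (M N : gradedModule K) (cM : coords M) (cN : coords N).
Variable m : series M -> series M.
Hypothesis mD : derivation1 m.
Hypothesis mm0 : forall d f, hatL d f -> forall s, m (m f) s = 0.

Variables (G : seq M -> M) (d : {linear M -> M}).
Hypothesis G0 : G [::] = 0.
Hypothesis G1 : forall v, G [:: v] = 0.
Hypothesis mE : forall q (a : {scalar M}), dual_deg q a -> forall y,
  m (gen a) y = (if y is [:: v] then a (d v) else 0) + a (G y).
Hypothesis GP : forall q (a b : {scalar M}), dual_deg q a ->
  (forall v, b v = a (d v)) ->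
  hatL (q + 1) (fun y => a (G y)) /\ forall y, m (fun y => a (G y)) y = - b (G y).

Variables (p : {linear M -> N}) (i : {linear N -> M}) (h : {linear M -> M}).
Hypothesis p_deg : forall k v, gm_gr k v -> gm_gr k (p v).
Hypothesis i_deg : forall k v, gm_gr k v -> gm_gr k (i v).
Hypothesis h_deg : forall k v, gm_gr k v -> gm_gr (k - 1) (h v).
Hypothesis pi1 : forall v, p (i v) = v.
Hypothesis di0 : forall v, d (i v) = 0.
Hypothesis dhE : forall v, d (h v) + h (d v) = i (p v) - v.

Variable eps : N -> N.
Hypothesis epsP : is_parity eps.

Let lin (w : seq N) : M := if w is [:: v] then i v else 0.

(** Iteration of F |-> i + h G(F, ..., F).  As G has no linear part, the value on a
    word of length n no longer changes after n steps. *)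
Fixpoint transfer_iter (n : nat) (w : seq N) : M :=
  if n is n'.+1 then lin w + h (pull (blocks (transfer_iter n')) G w) else lin w.

Definition transfer (w : seq N) : M := transfer_iter (size w) w.
Local Notation F := transfer.

Lemma transfer_iter_nil n : transfer_iter n [::] = 0.
Proof. by case: n => //= n; rewrite /pull big_seq1 G0 linear0 addr0. Qed.

Lemma transfer_iter_stable n n' w :
  (size w <= n)%N -> (size w <= n')%N -> transfer_iter n w = transfer_iter n' w.
Proof.
elim: n n' w => [|n IH] [|n'] w //=.
- by case: w => // _ _; rewrite /pull big_seq1 G0 linear0 addr0.
- by case: w => // _ _; rewrite /pull big_seq1 G0 linear0 addr0.
move=> wn wn'; congr (_ + h _); apply: eq_pull_blocks => // v vw.
by apply: IH; lia.
Qed.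

Lemma transferE w : F w = lin w + h (pull (blocks F) G w).
Proof.
rewrite {1}/F (transfer_iter_stable (n' := (size w).+1)) //=.
congr (_ + h _); apply: eq_pull_blocks => // v vw.
by apply: transfer_iter_stable => //; exact: ltnW.
Qed.

Lemma transfer_nil : F [::] = 0.
Proof. exact: transfer_iter_nil. Qed.

Lemma transfer_letter v : F [:: v] = i v.
Proof. by rewrite transferE /= /pull big_seq1 G1 linear0 addr0. Qed.

Local Notation phi := (pull (blocks F) : series M -> series N).

Definition transferQ (w : seq N) : N := p (pull (blocks F) G w).
Local Notation Q := transferQ.
Local Notation mU := (pull (slots eps Q) : series N -> series N).

Let hgenM q (a : {scalar M}) : dual_deg q a -> hatL q (gen a).
Proof. by move=> qa; apply: (lie_hatL cM); exact: lie_gen. Qed.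

Lemma hatL_G q (a : {scalar M}) : dual_deg q a -> hatL (q + 1) (fun y => a (G y)).
Proof. by move=> qa; have [b bE] := scalar_comp a d; have [] := GP qa bE. Qed.

Let pull_scalar (a : {scalar M}) (A : seq N -> seq (seq M)) w :
  pull A (fun y => a (G y)) w = a (pull A G w).
Proof. by rewrite /pull linear_sum. Qed.

Let dual_h q (a b : {scalar M}) : dual_deg q a -> (forall v, b v = a (h v)) ->
  dual_deg (q - 1) b.
Proof.
move=> qa bE k v vk; rewrite bE; have := qa _ _ (h_deg vk).
by have -> : q + (k - 1) = q - 1 + k by lia.
Qed.

(** Iterating, rather than recurring on words, makes this an induction in which the
    previous step is a morphism on the whole completed Lie algebra: a composed with
    h G(F, ..., F) is the image under it of the element (a h) G of that algebra. *)
Lemma transfer_iter_closL n q (a : {scalar M}) : dual_deg q a ->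
  closL q (fun w => a (transfer_iter n w)).
Proof.
elim: n q a => [|n IH] q a qa.
  have [b bE] := scalar_comp a i.
  have -> : (fun w => a (transfer_iter 0 w)) = gen b.
    by apply/funext => -[|v [|? ?]] /=; rewrite ?linear0 ?bE.
  by apply: closL_lie; apply: lie_gen => k v vk; rewrite bE; apply: qa; exact: i_deg.
have [b bE] := scalar_comp a i; have [c cE] := scalar_comp a h.
have -> : (fun w => a (transfer_iter n.+1 w)) =
    (fun w => gen b w + pull (blocks (transfer_iter n)) (fun y => c (G y)) w).
  apply/funext => w; rewrite pull_scalar /= linearD cE; congr (_ + _).
  by case: w => [|v [|? ?]] /=; rewrite ?linear0 ?bE.
apply: approxD.
  by apply: closL_lie; apply: lie_gen => k v vk; rewrite bE; apply: qa; exact: i_deg.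
apply: pull_blocks_closL; [exact: IH|exact: transfer_iter_nil|].
by rewrite -[q](subrK 1); apply: hatL_closL; apply: hatL_G; exact: dual_h cE.
Qed.

Lemma transfer_closL q (a : {scalar M}) : dual_deg q a -> closL q (fun w => a (F w)).
Proof.
move=> qa S; pose n := \max_(w <- S) size w.
have [g cg eg] := transfer_iter_closL n qa S; exists g => // w wS.
rewrite -eg // /F (@transfer_iter_stable _ n) //.
by rewrite /n (big_rem _ wS) /= leq_maxl.
Qed.

Lemma phi_closL q f : closL q f -> closL q (phi f).
Proof. by apply: pull_blocks_closL; [exact: transfer_closL|exact: transfer_nil]. Qed.

Lemma phi_operator : operator 0 phi.
Proof. by apply: (pull_operator cN) => q f hf; rewrite addr0; exact: phi_closL. Qed.

Lemma Q_nil : Q [::] = 0.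
Proof. by rewrite /Q /pull big_seq1 G0 linear0. Qed.

Lemma Q_letter v : Q [:: v] = 0.
Proof. by rewrite /Q /pull big_seq1 G1 linear0. Qed.

Let dual_p q (a : {scalar N}) (b : {scalar M}) : dual_deg q a ->
  (forall v, b v = a (p v)) -> dual_deg q b.
Proof. by move=> qa bE k v vk; rewrite bE; apply: qa; exact: p_deg. Qed.

Lemma Q_closL q (a : {scalar N}) : dual_deg q a -> closL (q + 1) (fun w => a (Q w)).
Proof.
move=> qa; have [b bE] := scalar_comp a p.
have -> : (fun w => a (Q w)) = phi (fun y => b (G y)).
  by apply/funext => w; rewrite pull_scalar bE.
by apply: phi_closL; apply: hatL_closL; apply: hatL_G; exact: dual_p bE.
Qed.

Lemma mU_operator : operator 1 mU.
Proof.
apply: (pull_operator cN) => q f hf.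
by apply: pull_slots_closL; [exact: epsP|exact: Q_closL|exact: Q_nil|].
Qed.

Lemma mU_brk q r f g : hatL q f -> hatL r g ->
  mU (brk q r f g) = brk (q + 1) r (mU f) g \+ sgn K q \*o brk q (r + 1) f (mU g).
Proof. by move=> /hatL_closL hf /hatL_closL hg; exact: pull_slots_brk. Qed.

Lemma mU_derivation : derivation1 mU.
Proof.
by split; [case: mU_operator|exact: pull_contL|exact: mU_brk].
Qed.

Lemma phi_lie_hom : lie_hom phi.
Proof.
split; [by case: phi_operator|exact: pull_contL|].
by move=> q r f g _ _; exact: pull_blocks_brk.
Qed.

Lemma mU_gen (a : {scalar N}) w : mU (gen a) w = a (Q w).
Proof. by apply: pull_slots_gen; exact: Q_nil. Qed.

Lemma phi_gen (a : {scalar M}) w : phi (gen a) w = a (F w).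
Proof. by apply: pull_blocks_gen; exact: transfer_nil. Qed.

Let phiD f g : phi (f \+ g) = phi f \+ phi g.
Proof. by apply/funext => w; rewrite /pull /= big_split. Qed.
Let phiZ c f : phi (c \*o f) = c \*o phi f.
Proof. by apply/funext => w; rewrite /pull /= mulr_sumr. Qed.
Let mUD f g : mU (f \+ g) = mU f \+ mU g.
Proof. by apply/funext => w; rewrite /pull /= big_split. Qed.
Let mUZ c f : mU (c \*o f) = c \*o mU f.
Proof. by apply/funext => w; rewrite /pull /= mulr_sumr. Qed.

Let E (f : series M) : series N := fun w => phi (m f) w - mU (phi f) w.

Let E_operator : operator 1 E.
Proof.
have mO := derivation_operator mD.
apply: (operatorB cN).
  by have := operator_comp mO phi_operator; rewrite addr0.
by have := operator_comp phi_operator mU_operator; rewrite add0r.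
Qed.

Let E_brk q r f g : hatL q f -> hatL r g -> E (brk q r f g) =
  fun s => brk (q + 1) r (E f) (phi g) s + sgn K q * brk q (r + 1) (phi f) (E g) s.
Proof.
move=> hf hg; apply/funext => w; rewrite /E.
have [_ _ mb] := mD; rewrite (mb q r) // phiD phiZ !pull_blocks_brk.
have [pd _ _] := phi_operator.1.
have hpf : hatL q (phi f) by have := pd _ _ hf; rewrite addr0.
have hpg : hatL r (phi g) by have := pd _ _ hg; rewrite addr0.
by rewrite mU_brk // brkBl brkBr /=; ring.
Qed.

(** With s = G(F, ..., F), so that F = i + h s and Q = p s, the left side is
    a (d h s + s - i p s) - m_U phi((a h) G), as d i = 0.  By d h = i p - 1 - h d the
    first term is - a h d s, which equals phi(m ((a h) G)) because
    m (b G) = - b d G for b = a h. *)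
Let E_gen q (a b : {scalar M}) w : dual_deg q a -> (forall v, b v = a (h v)) ->
  E (gen a) w = E (fun y => b (G y)) w.
Proof.
move=> qa bE; have [c cE] := scalar_comp b d.
have [e eE] := scalar_comp a d; have [ai aiE] := scalar_comp a i.
have qb := dual_h qa bE; have [_ mb] := GP qb cE.
pose s : M := pull (blocks F) G w.
rewrite /E (_ : m (gen a) = gen e \+ (fun y => a (G y))); last first.
  apply/funext => y; rewrite (mE qa) /=; congr (_ + _).
  by case: y => [|v [|? ?]] /=; rewrite ?eE.
rewrite (_ : phi (gen a) = gen ai \+ phi (fun y => b (G y))); last first.
  apply/funext => y; rewrite phi_gen transferE linearD /= pull_scalar bE.
  by congr (_ + _); case: y => [|v [|? ?]] /=; rewrite ?linear0 ?aiE.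
rewrite (_ : m (fun y => b (G y)) = (fun y => - c (G y))); last by apply/funext.
have -> : phi (fun y => - c (G y)) w = - c s by rewrite /pull sumrN -linear_sum.
rewrite phiD mUD /= phi_gen mU_gen pull_scalar eE aiE -/s.
have -> : a (d (F w)) = a (i (p s)) - a s - c s.
  rewrite cE bE transferE linearD -/s -linearB -linearB; congr (a _).
  rewrite -dhE addrK; case: (w) => [|v [|? ?]] /=; rewrite ?di0 ?linear0 add0r //.
by rewrite /Q -/s; ring.
Qed.

(** By additivity, X vanishes in length n once it does so on series without linear
    part and on one series for each linear part. *)
Let vanish_step (P : gradedModule K) (cP : coords P) (X : series P -> series N) r n :
  operator r X ->
  (forall q a, dual_deg q a -> exists f, [/\ hatL q f,
    forall v, f [:: v] = a v & forall w, size w = n -> X f w = 0]) ->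
  (forall q f, hatL q f -> (forall v, f [:: v] = 0) ->
    forall w, size w = n -> X f w = 0) ->
  forall q f, hatL q f -> forall w, size w = n -> X f w = 0.
Proof.
move=> [[_ aX _] _] hlin hrest q f hf w wn.
have [a qa fE] := linear_part hf; have [g [hg ga Xg]] := hlin _ _ qa.
have hfg : hatL q (fun s => f s - g s).
  by apply: (closL_hatL cP); apply: closLB; exact: hatL_closL.
have -> : f = (fun s => f s - g s) \+ g by apply/funext => s /=; rewrite subrK.
rewrite (aX q) //= Xg // addr0; apply: (hrest _ _ hfg) => // v.
by rewrite fE ga subrr.
Qed.

(** On a generator a, the defect E agrees with its value on (a h) G, which has no
    linear part and so is covered by the inductive step on the length of words. *)
Lemma phi_comm q f : hatL q f -> phi (m f) = mU (phi f).
Proof.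
move=> hf; apply/funext => w; apply/eqP; rewrite -subr_eq0; apply/eqP.
rewrite -[LHS]/(E f w); have [n] := ubnP (size w).
elim: n q f hf w => // n IH q f hf w; rewrite ltnS leq_eqVlt.
case/orP=> [/eqP wn|]; last exact: IH hf _.
have rest : forall q f, hatL q f -> (forall v, f [:: v] = 0) ->
    forall w, size w = n -> E f w = 0.
  apply: (leibniz_vanish cM (psi := phi) E_operator) => //.
  - by move=> q1 q2 f1 f2 h1 h2; exists (q1 + 1), (q2 + 1), (sgn K q1); exact: E_brk.
  - by move=> q1 f1 /hatL_closL/phi_closL/closL_nil.
apply: (vanish_step cM E_operator _ rest hf) => // r a qa.
have [b bE] := scalar_comp a h.
exists (gen a); split=> // [|w' w'n]; first exact: hgenM.
rewrite (E_gen _ qa bE); apply: (rest _ _ (hatL_G (dual_h qa bE))) => // v.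
by rewrite G1 linear0.
Qed.

(** The square of m_U is a derivation and vanishes on the image of phi, since
    m_U m_U phi = phi m m = 0.  As p i = 1, phi(a p) has linear part a, so what is
    left has no linear part. *)
Lemma mU_sq q f : hatL q f -> forall w, mU (mU f) w = 0.
Proof.
move=> hf w; have XO : operator (1 + 1) (fun f => mU (mU f)).
  exact: operator_comp mU_operator mU_operator.
have [n] := ubnP (size w).
elim: n q f hf w => // n IH q f hf w; rewrite ltnS leq_eqVlt.
case/orP=> [/eqP wn|]; last exact: IH hf _.
have [dU _ _] := mU_operator.1.
have rest : forall q f, hatL q f -> (forall v, f [:: v] = 0) ->
    forall w, size w = n -> mU (mU f) w = 0.
  apply: (leibniz_vanish cN (psi := id) XO) => //.
  - move=> q1 q2 f1 f2 h1 h2; exists (q1 + 1 + 1), (q2 + 1 + 1), 1.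
    rewrite mU_brk // mUD mUZ !mU_brk //; try exact: dU.
    apply/funext => s /=; rewrite sgnD sgn1; have := sgn_sq K q1.
    by move: (sgn K q1) => t tt; ring: tt.
  - by move=> q1 f1 /hatL_closL/closL_nil.
apply: (vanish_step cN XO _ rest hf) => // r a qa.
have [b bE] := scalar_comp a p; have qb := dual_p qa bE.
exists (phi (gen b)); split=> [|v|w' w'n].
- by have [pd _ _] := phi_operator.1; have := pd _ _ (hgenM qb); rewrite addr0.
- by rewrite phi_gen transfer_letter bE pi1.
- rewrite -(phi_comm (hgenM qb)) -(phi_comm (q := r + 1)); last first.
    by have [[dm _ _] _ _] := mD; apply: dm; exact: hgenM.
  by rewrite /pull big1 // => s _; exact: mm0 (hgenM qb) s.
Qed.

End Transfer.

(** * The minimal model *)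

Theorem corollary5p6 (K : gradedField) (V : cinfAlgebra K) :
  exists (U : cinfAlgebra K) (phi : cinfMorphism U V),
    minimal U /\ weak_equivalence phi.
Proof.
have [cV] := graded_free_coords (ci_free V).
have cM := susp_coords cV.
have [G [d [d_deg dd [G0 G1] mE GP]]] :=
  transpose_exists cM (ci_der V) (@ci_sq _ V).
have dV_deg k (v : V) : gm_gr k v -> gm_gr (k + 1) (d v : V).
  by have := d_deg (k - 1) v; rewrite /= !subrK.
have [S [p' [i' [h [pS piS pd dhE hi_deg]]]]] :=
  contraction_exists cV (d := (d : {linear V -> V})) dV_deg dd.
pose U := spanM S.
have [cU] := span_coords S.
have [p pE] := to_span pS; have [i iE] := of_span S i'.
have cN := susp_coords cU.
have [eps [epsP _]] := parity_exists cN.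
have [epsV [epsVP epsV_gr]] := parity_exists cM.
have p_deg k (v : susp V) : gm_gr k v -> @gm_gr _ (susp U) k (p v).
  by move=> /hi_deg[vk _ _]; rewrite /= /span_gr /mkset pE.
have i_deg k (v : susp U) : gm_gr k v -> @gm_gr _ (susp V) k (i v).
  by rewrite /= iE => /hi_deg[].
have h_deg k (v : susp V) : gm_gr k v -> @gm_gr _ (susp V) (k - 1) (h v).
  by move=> /hi_deg[_ _]; rewrite /= addrAC.
have pi1 (v : U) : p (i v) = v.
  by apply: val_inj; rewrite pE iE; case: (piS _ (span_valP v)).
have di0 (v : U) : d (i v) = 0.
  by rewrite iE; case: (piS _ (span_valP v)).
have dhE' (v : V) : d (h v) + h (d v) = i (p v) - v.
  by rewrite dhE iE pE.
have pd0 (v : V) : p (d v) = 0 by apply: val_inj; rewrite pE pd.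
pose F := @transfer K (susp V) (susp U) G i h.
pose mU := pull (slots eps (@transferQ K (susp V) (susp U) G p i h)) :
  series (susp U) -> series (susp U).
have derU : derivation1 mU.
  exact: (mU_derivation cN G0 G1 GP p_deg i_deg h_deg epsP).
have sqU q f : hatL q f -> forall w, mU (mU f) w = 0.
  exact: (mU_sq cM cN (ci_der V) (@ci_sq _ V) G0 G1 mE GP p_deg i_deg h_deg pi1
    di0 dhE' epsP).
pose algU := CinfAlgebra (coords_graded_free cU) derU sqU.
have homF : lie_hom (pull (blocks F) : series (susp V) -> series (susp U)).
  exact: (phi_lie_hom cN G0 G1 GP i_deg h_deg).
have commF q f : hatL q f -> pull (blocks F) (ci_m f) = mU (pull (blocks F) f).
  exact: (phi_comm cM cN (ci_der V) G0 G1 mE GP p_deg i_deg h_deg di0 dhE' epsP).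
exists algU, (@CinfMorphism _ algU V _ homF commF).
have mU1 (a : {scalar susp U}) v : mU (gen a) [:: v] = 0.
  by rewrite [LHS](mU_gen G0 p i h eps a) (Q_letter G1) linear0.
split=> [q a _ v|]; first exact: mU1.
(* The sign in the transpose of a map of degree 1 turns d into eps d. *)
have [dU dUE] : exists f : {linear V -> V}, forall v, f v = epsV (d v).
  have [|f fE] := @linear_of K V V (fun v => epsV (d v)); last by exists f.
  by move=> a x y; rewrite !linearP.
exists (\0 : {linear U -> U}), dU, i; split.
- by move=> q a _ v; rewrite [LHS]mU1 /= linear0 mulr0.
- move=> q a qa v; rewrite (mE _ _ qa) G1 linear0 addr0 dUE (epsVP _ _ qa).
  by rewrite mulrA sgn_sq mul1r.
- by move=> q a qa v; rewrite [LHS](phi_gen G0 i h a) (transfer_letter G0 G1).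
have sgnK k (v : V) : sgn K k *: (sgn K k *: v) = v.
  by rewrite scalerA sgn_sq scale1r.
have dU_gr k v : @gm_gr _ V k v -> dU v = sgn K k *: d v.
  move=> vk; rewrite dUE; apply: epsV_gr; exact: dV_deg.
split=> [n v vn|v|n v vn _ [u un uE]|n u un u0].
- by rewrite iE; case: (hi_deg _ _ vn).
- by rewrite /= linear0 dUE di0 linear0.
- exists 0; first exact: (gr0 (gm_grading U)).
  by rewrite /= -(pi1 v) uE (dU_gr _ _ un) linearZ pd0 [LHS]scaler0.
have du0 : d u = 0 by rewrite -(sgnK n (d u)) -(dU_gr _ _ un) u0 scaler0.
exists (p u); first by rewrite /= /span_gr /mkset pE; case: (hi_deg _ _ un).
split=> //; have hu : gm_gr (n - 1) (h u) by case: (hi_deg _ _ un).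
(* As d u = 0, d h u = i p u - u; the scalar removes the sign of the differential. *)
have wu : gm_gr (n - 1) (- sgn K (n - 1) *: h u).
  rewrite -[n - 1]add0r; apply: gm_scale; last exact: hu.
  apply: (grN (gf_grading K)); rewrite -[sgn K _]mulr1.
  by apply: gf_gr_sgn; exact: gf_one.
exists (- sgn K (n - 1) *: h u); first exact: wu.
rewrite (dU_gr _ _ wu) [d _]linearZ /= scaleNr scalerN sgnK.
have := dhE' u; rewrite du0 linear0 addr0 => ->.
by apply/esym; exact: opprB.
Qed.
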